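(* Let $\boldsymbol{X}_0\in\mathbb{R}^{n\times n}$ be a fixed positive semidefinite (PSD) matrix of rank $r$. Let $\boldsymbol{a}_1,\dots,\boldsymbol{a}_m\in\mathbb{R}^n$ be sensing vectors whose entries are i.i.d. standard Gaussian, and define the linear map $\mathcal{A}:\mathbb{R}^{n\times n}\to\mathbb{R}^m$ by $\mathcal{A}(\boldsymbol{X})=\{\boldsymbol{a}_i^T\boldsymbol{X}\boldsymbol{a}_i\}_{i=1}^m$. Observe $\boldsymbol{z}=\mathcal{A}(\boldsymbol{X}_0)+\boldsymbol{\beta}+\boldsymbol{w}\in\mathbb{R}^m$, where the noise satisfies $\|\boldsymbol{w}\|_1\le\epsilon$ and the outlier vector $\boldsymbol{\beta}$ has $\|\boldsymbol{\beta}\|_0=sm$ nonzero entries of arbitrary magnitudes, its support is selected uniformly at random, and the signs of its nonzero entries are Rademacher, i.e. $\mathbb{P}\{\mathrm{sgn}(\beta_i)=-1\}=\mathbb{P}\{\mathrm{sgn}(\beta_i)=1\}=1/2$ for each $i\in\mathrm{supp}(\boldsymbol{\beta})$. Let $\hat{\boldsymbol{X}}$ be a solution to $$\hat{\boldsymbol{X}}=\mathrm{argmin}_{\boldsymbol{X}\succeq 0}\ \|\boldsymbol{z}-\mathcal{A}(\boldsymbol{X})\|_1 .$$ Then there exist absolute constants $c_1>0$ and $0<s_0<1$ such that, as long as $m\ge c_1 n r^2$ and $s\le s_0/r$, the solution satisfies $$\|\hat{\boldsymbol{X}}-\boldsymbol{X}_0\|_{\mathrm{F}}\le c_2\frac{r\epsilon}{m}$$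 with probability exceeding $1-\exp(-\gamma m/r^2)$, for some constants $c_2$ and $\gamma$.
   Context: $\|\cdot\|_{\mathrm{F}}$ is the Frobenius norm, $\|\cdot\|_1$ and $\|\cdot\|_0$ are the $\ell_1$-norm and the number of nonzero entries of a vector, and $\boldsymbol{X}\succeq 0$ means $\boldsymbol{X}$ is symmetric positive semidefinite. $s=\|\boldsymbol{\beta}\|_0/m$ is the fraction of corrupted measurements. *)

(* Defs.v *)
From HB Require Import structures.
From mathcomp Require Import all_boot all_order all_algebra.
From mathcomp Require Import all_classical all_reals all_analysis.
From mathcomp Require Import normal_distribution.
Set Implicit Arguments. Unset Strict Implicit. Unset Printing Implicit Defensive.
Import Order.TTheory GRing.Theory Num.Theory.
Local Open Scope classical_set_scope.
Local Open Scope ring_scope.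

Section Defs.
Variable R : realType.

Definition psd (n : nat) (X : 'M[R]_n) : Prop :=
  X^T = X /\ forall v : 'cV[R]_n, 0 <= (v^T *m X *m v) 0 0.

Definition frob (p q : nat) (X : 'M[R]_(p, q)) : R :=
  Num.sqrt (\sum_(i < p) \sum_(j < q) X i j ^+ 2).

Definition l1norm (m : nat) (v : 'I_m -> R) : R := \sum_(i < m) `|v i|.

Definition Aop (m n : nat) (a : 'M[R]_(m, n)) (X : 'M[R]_n) : 'I_m -> R :=
  fun i => (row i a *m X *m (row i a)^T) 0 0.

Definition is_l1_minimizer (m n : nat) (a : 'M[R]_(m, n)) (z : 'I_m -> R)
    (Xh : 'M[R]_n) : Prop :=
  psd Xh /\ forall X : 'M[R]_n, psd X ->
    l1norm (fun i => z i - Aop a Xh i) <= l1norm (fun i => z i - Aop a X i).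

(* mutual independence of a finite family of collections of events:
   the product rule holds for every choice of one event in each collection
   (choosing the sure event recovers every subfamily). *)
Definition indep_events d (T : measurableType d) (P : probability T R)
    (I : finType) (F : I -> set (set T)) : Prop :=
  forall E : I -> set T, (forall i, F i (E i)) ->
    P [set t | forall i, E i t] = (\big[*%E/1%E]_(i : I) P (E i))%E.

Definition events_of_real d (T : measurableType d) (X : T -> R) : set (set T) :=
  [set X @^-1` B | B in [set B : set R | measurable B]].

Definition events_of_fin d (T : measurableType d) (U : finType) (Y : T -> U)
    : set (set T) :=
  [set Y @^-1` D | D in [set: set U]].

End Defs.

(* Main.v *)
Require Import Defs.
From HB Require Import structures.
From mathcomp Require Import all_boot all_order all_algebra.
From mathcomp Require Import all_classical all_reals all_analysis.
From mathcomp Require Import normal_distribution measurable_realfun.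
From mathcomp Require Import ring lra.
Import Order.TTheory GRing.Theory Num.Theory.
Local Open Scope classical_set_scope.
Local Open Scope ring_scope.
Set Implicit Arguments.
Unset Strict Implicit.
Unset Printing Implicit Defensive.

(** Put H = Xh - X0, let h be its operator norm and C its compression to the
    kernel of X0, which is PSD, and set N = 2 r h + tr C.  Since H - C has nuclear
    norm at most 2 r h, every symmetric M with |u M u^T| <= s |u|^2 satisfies
    |tr (M H)| <= s N, and the Frobenius norm of H is at most N.

    For a_i standard Gaussian and |v| <= 1, the bounded weight cos (v . a_i) gives
    E[cos (v . a_i) a_i^T a_i] = alpha (I - v^T v) with alpha >= 1/2.  Hence, if the
    empirical mean of these matrices is within s of its expectation, the quantity
    alpha |tr H - v H v^T| is at most F + s N, where F is the mean of |a_i H a_i^T|.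
    The case v = 0 bounds tr H, the other ones bound h, and so N <= C r (F + s N).
    Optimality of Xh gives F <= 2 F_S + 2 eps / m, where F_S, the contribution of the
    corrupted measurements, is at most s N again.  With s of order 1 / r this
    absorbs N and leaves N <= c r eps / m.

    The concentration holds with probability 1 - exp (- c m / r^2) by a Chernoff bound
    over an exponential-size net of the unit ball, for a fixed support, and then for
    the random one, which is independent of the a_i. *)

(** * Bilinear forms and the trace duality *)

(** The minimizer depends on the a_i, so concentration for a fixed H is of no use. Every
    probabilistic estimate therefore concerns quadratic forms in the a_i alone, uniformly over
    directions, and is paired with H only afterwards; the price of the pairing is the nuclear norm
    of H, for which N stands in. The lower bound on F is a duality between l1 and bounded weights: F
    dominates the mean of c_i a_i H a_i^T for any |c_i| <= 1, and the cosine is a bounded weight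
    whose expected matrix is explicit by Gaussian integration by parts.

    The power r^2 comes from s: a deviation s = 1 / (408 r), uniform over exp (O (n)) directions,
    costs m s^2 of order n, that is m of order n r^2. Letting v run over the same net only squares
    its cardinal. The random support adds no entropy: the bound for a fixed support is averaged over
    supports, not summed.

    Spectral theory is replaced by quadratic forms throughout: suprema of |u M u^T|, sums of
    rank-one squares, and orthonormalization of rows. *)

Section BilinearForms.
Variable R : realType.

Definition dot n (u v : 'rV[R]_n) : R := (u *m v^T) 0 0.

Definition bf n (M : 'M[R]_n) (u v : 'rV[R]_n) : R := (u *m M *m v^T) 0 0.

Lemma dotE n (u v : 'rV[R]_n) : dot u v = \sum_j u 0 j * v 0 j.
Proof. by rewrite /dot mxE; apply: eq_bigr => j _; rewrite mxE. Qed.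

Lemma dotC n (u v : 'rV[R]_n) : dot u v = dot v u.
Proof. by rewrite !dotE; apply: eq_bigr => j _; rewrite mulrC. Qed.

Lemma dotDl n (u v w : 'rV[R]_n) : dot (u + v) w = dot u w + dot v w.
Proof. by rewrite /dot mulmxDl mxE. Qed.

Lemma dotZl n c (u v : 'rV[R]_n) : dot (c *: u) v = c * dot u v.
Proof. by rewrite /dot -scalemxAl mxE. Qed.

Lemma dotNl n (u v : 'rV[R]_n) : dot (- u) v = - dot u v.
Proof. by rewrite /dot mulNmx mxE. Qed.

Lemma dotDr n (u v w : 'rV[R]_n) : dot w (u + v) = dot w u + dot w v.
Proof. by rewrite dotC dotDl !(dotC _ w). Qed.

Lemma dotZr n c (u v : 'rV[R]_n) : dot v (c *: u) = c * dot v u.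
Proof. by rewrite dotC dotZl dotC. Qed.

Lemma dotNr n (u v : 'rV[R]_n) : dot v (- u) = - dot v u.
Proof. by rewrite dotC dotNl dotC. Qed.

Lemma dot_ge0 n (u : 'rV[R]_n) : 0 <= dot u u.
Proof. by rewrite dotE sumr_ge0 // => j _; rewrite -expr2 sqr_ge0. Qed.

Lemma dot_eq0 n (u : 'rV[R]_n) : dot u u = 0 -> u = 0.
Proof.
rewrite dotE => /eqP; rewrite psumr_eq0; last first.
  by move=> j _; rewrite -expr2 sqr_ge0.
move=> /allP u0; apply/rowP => j; rewrite mxE; apply/eqP.
by have := u0 j (mem_index_enum _); rewrite /= mulf_eq0 orbb.
Qed.

Lemma dot_mulmx n p (u : 'rV[R]_n) (A : 'M[R]_(n, p)) (v : 'rV[R]_p) :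
  dot (u *m A) v = dot u (v *m A^T).
Proof. by rewrite /dot trmx_mul trmxK mulmxA. Qed.

Lemma bfDl n (M : 'M[R]_n) u v w : bf M (u + v) w = bf M u w + bf M v w.
Proof. by rewrite /bf !mulmxDl mxE. Qed.

Lemma bfDr n (M : 'M[R]_n) u v w : bf M w (u + v) = bf M w u + bf M w v.
Proof. by rewrite /bf linearD mulmxDr mxE. Qed.

Lemma bfZl n (M : 'M[R]_n) c u v : bf M (c *: u) v = c * bf M u v.
Proof. by rewrite /bf -!scalemxAl mxE. Qed.

Lemma bfZr n (M : 'M[R]_n) c u v : bf M u (c *: v) = c * bf M u v.
Proof. by rewrite /bf linearZ -scalemxAr mxE. Qed.

Lemma bfNl n (M : 'M[R]_n) u v : bf M (- u) v = - bf M u v.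
Proof. by rewrite -scaleN1r bfZl mulN1r. Qed.

Lemma bfNr n (M : 'M[R]_n) u v : bf M u (- v) = - bf M u v.
Proof. by rewrite -scaleN1r bfZr mulN1r. Qed.

Lemma bf_addmx n (M N : 'M[R]_n) u v : bf (M + N) u v = bf M u v + bf N u v.
Proof. by rewrite /bf mulmxDr mulmxDl mxE. Qed.

Lemma bf_scalemx n c (M : 'M[R]_n) u v : bf (c *: M) u v = c * bf M u v.
Proof. by rewrite /bf -scalemxAr -scalemxAl mxE. Qed.

Lemma bf_oppmx n (M : 'M[R]_n) u v : bf (- M) u v = - bf M u v.
Proof. by rewrite -scaleN1r bf_scalemx mulN1r. Qed.

Lemma bf_sum n I (s : seq I) (P : pred I) (M : I -> 'M[R]_n) u v :
  bf (\sum_(i <- s | P i) M i) u v = \sum_(i <- s | P i) bf (M i) u v.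
Proof.
elim/big_rec2: _ => [|i x N _ <-]; first by rewrite /bf mulmx0 mul0mx mxE.
by rewrite bf_addmx.
Qed.

Lemma bf1 n (u v : 'rV[R]_n) : bf 1%:M u v = dot u v.
Proof. by rewrite /bf mulmx1. Qed.

Lemma bfC n (M : 'M[R]_n) u v : M^T = M -> bf M u v = bf M v u.
Proof.
move=> Ms; have tr11 (A : 'M[R]_1) : A 0 0 = A^T 0 0 by rewrite mxE.
by rewrite /bf tr11 !trmx_mul trmxK Ms mulmxA.
Qed.

Lemma bf_dotl n (M : 'M[R]_n) u v : bf M u v = dot (u *m M) v.
Proof. by []. Qed.

Lemma bf_outer n (x u v : 'rV[R]_n) : bf (x^T *m x) u v = dot u x * dot x v.
Proof.
rewrite /bf !mulmxA -[_ *m x *m _]mulmxA mxE big_ord1 /dot.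
by [].
Qed.

Lemma mxtrace11 (A : 'M[R]_1) : \tr A = A 0 0.
Proof. by rewrite /mxtrace big_ord1. Qed.

Lemma trace_outer n (x : 'rV[R]_n) (H : 'M[R]_n) : \tr (x^T *m x *m H) = bf H x x.
Proof. by rewrite -mulmxA mxtrace_mulC mxtrace11. Qed.

Lemma trace_sum_rows n k (E : 'M[R]_(k, n)) (A : 'M[R]_n) :
  \tr (E *m A *m E^T) = \sum_i bf A (row i E) (row i E).
Proof.
apply: eq_bigr => i _.
rewrite /bf -row_mul mxE [RHS]mxE; apply: eq_bigr => j _.
by congr (_ * _); rewrite !mxE.
Qed.

Lemma dot_CS n (u v : 'rV[R]_n) : dot u v ^+ 2 <= dot u u * dot v v.
Proof.
have [v0|v0] := eqVneq (dot v v) 0.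
  by rewrite v0 mulr0 (dot_eq0 v0) dotC /dot mul0mx mxE expr0n.
have vp : 0 < dot v v by rewrite lt_neqAle eq_sym v0 dot_ge0.
have := dot_ge0 (dot v v *: u - dot u v *: v).
rewrite !(dotDl, dotDr, dotNl, dotNr, dotZl, dotZr) (dotC v u).
set x := dot u u; set y := dot v v in vp v0 *; set z := dot u v => h.
have {}h : 0 <= y * (x * y - z ^+ 2) by move: h; congr (_ <= _); ring.
by rewrite pmulr_rge0 // subr_ge0 in h.
Qed.

(** Polarization, then the parallelogram law for |u + v|^2 + |u - v|^2. *)
Lemma bf_polar n (M : 'M[R]_n) s : M^T = M ->
  (forall u, `|bf M u u| <= s * dot u u) ->
  forall u v, `|bf M u v| <= s / 2 * (dot u u + dot v v).
Proof.
move=> Ms hs u v.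
have -> : bf M u v = (bf M (u + v) (u + v) - bf M (u - v) (u - v)) / 4.
  by rewrite !(bfDl, bfDr, bfNl, bfNr) (bfC v u Ms); field.
rewrite normrM (gtr0_norm (_ : 0 < 4^-1)) ?invr_gt0 //.
rewrite ler_pdivrMr //; apply: le_trans (ler_normB _ _) _.
apply: le_trans (lerD (hs _) (hs _)) _.
rewrite !(dotDl, dotDr, dotNl, dotNr) (dotC v u) le_eqVlt; apply/orP; left.
by apply/eqP; field.
Qed.

(** With w = u M, the polarized bound at (s u, w) reads s |w|^2 <= s / 2 (s^2 |u|^2 + |w|^2). The
    scaling by s balances the two squares; the division by s is why s = 0 is treated apart. *)
Lemma bf_op n (M : 'M[R]_n) s : 0 <= s -> M^T = M ->
  (forall u, `|bf M u u| <= s * dot u u) ->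
  forall u, dot (u *m M) (u *m M) <= s ^+ 2 * dot u u.
Proof.
move=> s0 Ms hs u; set w := u *m M.
have ww : dot w w = bf M u w by [].
have [z|z] := eqVneq s 0.
  have := bf_polar Ms hs u w; rewrite -ww z mul0r mul0r normr_le0 => /eqP ->.
  by rewrite expr0n mul0r.
have sp : 0 < s by rewrite lt_neqAle eq_sym z.
have := bf_polar Ms hs (s *: u) w; rewrite bfZl -ww !(dotZl, dotZr).
rewrite ger0_norm ?mulr_ge0 ?dot_ge0 // => h.
have : s * dot w w <= s * (s ^+ 2 * dot u u).
  by move: h; set x := dot w w; set y := dot u u; lra.
by rewrite ler_pM2l.
Qed.

End BilinearForms.

(** * Positive semidefinite matrices as sums of squares, and orthonormal bases *)

Section PositiveSemidefinite.
Variable R : realType.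

Lemma psdP n (X : 'M[R]_n) :
  psd X <-> X^T = X /\ forall u, 0 <= bf X u u.
Proof.
split=> -[Xs X0]; split=> // u; first by have := X0 u^T; rewrite trmxK.
by have := X0 u^T; rewrite /bf trmxK.
Qed.

Lemma psd_CS n (X : 'M[R]_n) u v : psd X ->
  bf X u v ^+ 2 <= bf X u u * bf X v v.
Proof.
move=> /psdP[Xs X0]; set z := bf X u v.
have q a b : 0 <= a ^+ 2 * bf X u u + a * b * z *+ 2 + b ^+ 2 * bf X v v.
  have := X0 (a *: u + b *: v).
  by rewrite !(bfDl, bfDr, bfZl, bfZr) (bfC v u Xs) -/z; congr (_ <= _); ring.
have := X0 u; have := X0 v; rewrite le_eqVlt; move: q.
set x := bf X u u; set y := bf X v v => q /orP[/eqP y0 x0|y0 _].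
  (* When y = 0 the form is affine in b, and this choice leaves - z^2 (x + 2) >= 0, which forces z =
     0. *)
  rewrite -y0 mulr0; have := q z (- (x + 1)).
  rewrite -y0 mulr0 addr0 => h.
  have : z ^+ 2 * (x + 2) <= 0 by move: h; lra.
  by rewrite pmulr_lle0 //; lra.
have := q y (- z) => h.
have : 0 <= y * (x * y - z ^+ 2) by move: h; congr (_ <= _); ring.
by rewrite pmulr_rge0 // subr_ge0.
Qed.

Lemma row_delta_bf n (X : 'M[R]_n) i (v : 'rV[R]_n) :
  bf X (delta_mx 0 i) v = dot (row i X) v.
Proof. by rewrite /bf -rowE. Qed.

(** Cholesky elimination. The list [s] contains the indices whose rows may still be nonzero. A zero
    pivot forces its whole row to vanish by Cauchy-Schwarz; otherwise the Schur complement [Z] is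
    again PSD, also by Cauchy-Schwarz, and loses the row [i]. *)
Lemma psd_gram n (X : 'M[R]_n) : psd X ->
  exists l : seq 'rV[R]_n, X = \sum_(x <- l) x^T *m x.
Proof.
suff main (s : seq 'I_n) : forall Y : 'M[R]_n, psd Y ->
    (forall i, i \notin s -> row i Y = 0) ->
    exists l : seq 'rV[R]_n, Y = \sum_(x <- l) x^T *m x.
  by move=> Xp; apply: (main (enum 'I_n)) => // i; rewrite mem_enum.
elim: s => [|i s IH] Y Yp Y0.
  exists [::]; rewrite big_nil; apply/row_matrixP => i.
  by rewrite Y0 // row0.
have [Ys Yge] := (psdP Y).1 Yp.
set e : 'rV[R]_n := delta_mx 0 i; set c := bf Y e e.
have [c0|c0] := eqVneq c 0.
  apply: IH => // j; rewrite -[j \notin s]/(~~ (j \in s)) => js.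
  have [->|ji] := eqVneq j i; last by apply: Y0; rewrite inE negb_or ji.
  apply: dot_eq0; rewrite -row_delta_bf -/e.
  have := psd_CS e (row i Y) Yp; rewrite -/c c0 mul0r => h.
  by apply/eqP; rewrite -sqrf_eq0 eq_le h sqr_ge0.
have cp : 0 < c by rewrite lt_neqAle eq_sym c0 Yge.
set y := e *m Y; set Z := Y - c^-1 *: (y^T *m y).
have bZ u v : bf Z u v = bf Y u v - c^-1 * (bf Y u e * bf Y e v).
  rewrite /Z bf_addmx bf_oppmx bf_scalemx bf_outer (dotC u) -!bf_dotl.
  by rewrite -/e (bfC e u Ys).
have Zp : psd Z.
  apply/psdP; split=> [|u].
    by rewrite /Z linearB linearZ /= trmx_mul trmxK Ys.
  rewrite bZ (bfC u e Ys) -expr2 subr_ge0 ler_pdivrMl //.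
  exact: psd_CS.
have [|l Zl] := IH Z Zp.
  move=> j js; apply: dot_eq0; rewrite -row_delta_bf bZ.
  set f : 'rV[R]_n := delta_mx 0 j.
  have [ji|ji] := eqVneq j i.
    by rewrite /f ji -/e -/c mulrA mulVf // mul1r subrr.
  have fY v : bf Y f v = 0.
    by rewrite row_delta_bf Y0 ?inE ?negb_or ?ji // /dot mul0mx mxE.
  by rewrite !fY mul0r mulr0 subrr.
exists ((Num.sqrt c)^-1 *: y :: l); rewrite big_cons -Zl /Z.
rewrite [X in X *m _]linearZ -scalemxAl -scalemxAr scalerA -invfM -expr2 sqr_sqrtr ?ltW //.
by rewrite addrC subrK.
Qed.

Lemma trace_gram n (l : seq 'rV[R]_n) (M : 'M[R]_n) :
  \tr ((\sum_(x <- l) x^T *m x) *m M) = \sum_(x <- l) bf M x x.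
Proof.
rewrite mulmx_suml raddf_sum /=; apply: eq_bigr => x _; exact: trace_outer.
Qed.

Lemma trace_mul_psd n (M C : 'M[R]_n) s : psd C ->
  (forall u, `|bf M u u| <= s * dot u u) -> `|\tr (M *m C)| <= s * \tr C.
Proof.
move=> /psd_gram[l ->] Ms; rewrite mxtrace_mulC -[X in _ * \tr X]mulmx1.
rewrite !trace_gram mulr_sumr; apply: le_trans (ler_norm_sum _ _ _) _.
by apply: ler_sum => x _; rewrite bf1.
Qed.

(** Gram-Schmidt, one row at a time; a row whose residual [y] vanishes is dropped, so that k ends up
    being the rank. *)
Lemma orthonormal_rows p n (A : 'M[R]_(p, n)) :
  exists k (E : 'M[R]_(k, n)),
    [/\ E *m E^T = 1%:M, (A <= E)%MS & (E <= A)%MS].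
Proof.
elim: p A => [|p IH] A.
  by exists 0%N, A; split=> //; apply/matrixP => -[].
rewrite -[p.+1]/(1 + p)%N in A *; rewrite -[A]vsubmxK.
set u := usubmx _; set B := dsubmx _.
have [k [E [E1 BE EB]]] := IH B.
set y := u - u *m E^T *m E.
have yE : y *m E^T = 0.
  by rewrite mulmxBl -!mulmxA E1 mulmx1 subrr.
have [y0|y0] := eqVneq y 0.
  exists k, E; split=> //.
    rewrite col_mx_sub BE andbT.
    by move/eqP: y0; rewrite subr_eq0 => /eqP ->; rewrite submxMl.
  by rewrite (submx_trans EB) // -addsmxE addsmxSr.
have yy : 0 < dot y y.
  rewrite lt_neqAle dot_ge0 andbT eq_sym; apply: contra_neq y0; exact: dot_eq0.
set e := (Num.sqrt (dot y y))^-1 *: y.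
exists (1 + k)%N, (col_mx e E); split.
- rewrite tr_col_mx mul_col_row E1.
  have eE : e *m E^T = 0 by rewrite -scalemxAl yE scaler0.
  have -> : E *m e^T = 0 by rewrite -[E]trmxK -trmx_mul eE trmx0.
  rewrite eE; have -> : e *m e^T = 1%:M.
    apply/rowP => j; rewrite ord1 -/(dot e e) dotZl dotZr mulrA -invfM -expr2.
    by rewrite sqr_sqrtr ?ltW // mulVf ?gt_eqF // mxE.
  by rewrite -scalar_mx_block.
- rewrite col_mx_sub; apply/andP; split; last first.
    by rewrite (submx_trans BE) // -addsmxE addsmxSr.
  have -> : u = y + u *m E^T *m E by rewrite subrK.
  rewrite addmx_sub //; last first.
    by rewrite (submx_trans (submxMl _ _)) // -addsmxE addsmxSr.
  have -> : y = Num.sqrt (dot y y) *: e.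
    by rewrite scalerA mulfV ?scale1r // gt_eqF // sqrtr_gt0.
  by rewrite scalemx_sub // -addsmxE addsmxSl.
- have EA : (E <= col_mx u B)%MS.
    by rewrite (submx_trans EB) // -addsmxE addsmxSr.
  rewrite col_mx_sub EA andbT scalemx_sub // addmx_sub //.
    by rewrite -addsmxE addsmxSl.
  by rewrite eqmx_opp (submx_trans (submxMl _ _)).
Qed.

Lemma orthonormal_rank k n (E : 'M[R]_(k, n)) : E *m E^T = 1%:M -> \rank E = k.
Proof.
move=> E1; apply/eqP; rewrite eqn_leq rank_leq_row /=.
by rewrite -[X in (X <= _)%N](mxrank1 R) -E1 mxrankM_maxl.
Qed.

End PositiveSemidefinite.

(** * Compression, quadratic operator norm, and passage from a net to all vectors *)

Section RecoveryFromNet.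
Variable R : realType.

Lemma norm_dot_le n (x y : 'rV[R]_n) a b : 0 <= a -> 0 <= b ->
  dot x x <= a ^+ 2 -> dot y y <= b ^+ 2 -> `|dot x y| <= a * b.
Proof.
move=> a0 b0 xa yb; rewrite -(@ler_pXn2r _ 2) ?nnegrE ?mulr_ge0 //.
rewrite real_normK ?num_real // exprMn; apply: le_trans (dot_CS _ _) _.
by apply: ler_pM => //; exact: dot_ge0.
Qed.

Section Compression.
Variables (n k : nat) (E : 'M[R]_(k, n)).
Hypothesis E1 : E *m E^T = 1%:M.

(** The orthogonal projection onto the complement of the row span of [E]. When [E] spans the rows of
    the symmetric [X0], this complement is the kernel of [X0]. *)
Definition coproj : 'M[R]_n := 1%:M - E^T *m E.

Lemma coproj_sym : coproj^T = coproj.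
Proof. by rewrite linearB /= trmx1 trmx_mul trmxK. Qed.

Lemma coproj_idem : coproj *m coproj = coproj.
Proof.
rewrite {1}/coproj mulmxBl mul1mx /coproj mulmxBr mulmx1 !mulmxA.
by rewrite -[E^T *m E *m E^T]mulmxA E1 mulmx1 subrr subr0.
Qed.

Lemma dot_coproj_le x : dot (x *m coproj) (x *m coproj) <= dot x x.
Proof.
rewrite dot_mulmx coproj_sym -mulmxA coproj_idem /coproj mulmxBr mulmx1.
rewrite dotDr dotNr mulmxA.
have -> : dot x (x *m E^T *m E) = dot (x *m E^T) (x *m E^T).
  by rewrite [RHS]dot_mulmx trmxK.
by rewrite gerBl dot_ge0.
Qed.

Lemma dot_row_orthonormal i : dot (row i E) (row i E) = 1.
Proof.
have := congr1 (fun A : 'M[R]_k => A i i) E1; rewrite [RHS]mxE eqxx mulr1n => <-.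
by rewrite /dot mxE [RHS]mxE; apply: eq_bigr => j _; rewrite !mxE.
Qed.

(* H differs from its compression by E^T E H + coproj H E^T E,
   a matrix of nuclear norm at most 2 k h *)
Lemma trace_mul_compress_le (H M : 'M[R]_n) h s :
  H^T = H -> M^T = M -> 0 <= h -> 0 <= s ->
  (forall u, `|bf H u u| <= h * dot u u) ->
  (forall u, `|bf M u u| <= s * dot u u) ->
  `|\tr (M *m H) - \tr (M *m (coproj *m H *m coproj))| <= 2 * k%:R * h * s.
Proof.
move=> Hs Ms h0 s0 Hh Mb.
have row_le x y : (forall i, dot (row i x) (row i x) <= h ^+ 2) ->
    (forall i, dot (row i y) (row i y) <= s ^+ 2) ->
    `|\sum_(i < k) dot (row i x) (row i y)| <= k%:R * (h * s).
  move=> xh ys; apply: le_trans (ler_norm_sum _ _ _) _.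
  rewrite -[X in X%:R](card_ord k) mulr_natl -sumr_const; apply: ler_sum => i _.
  exact: norm_dot_le.
(* The trace is a sum of k inner products of e_i H with e_i M, of norms at most h and s since e_i is
   a unit vector. *)
have hP : `|\tr (M *m (E^T *m E *m H))| <= k%:R * (h * s).
  have -> : \tr (M *m (E^T *m E *m H)) =
      \sum_(i < k) dot (row i (E *m H)) (row i (E *m M)).
    rewrite (_ : _ *m _ = (M *m E^T) *m (E *m H)); last by rewrite !mulmxA.
    rewrite mxtrace_mulC mulmxA -[E *m H *m M]mulmxA trace_sum_rows; apply: eq_bigr => i _.
    by rewrite bf_dotl mulmxA dot_mulmx Ms !row_mul.
  apply: row_le => i; rewrite row_mul.
    by apply: le_trans (bf_op h0 Hs Hh _) _; rewrite dot_row_orthonormal mulr1.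
  by apply: le_trans (bf_op s0 Ms Mb _) _; rewrite dot_row_orthonormal mulr1.
have hQ : `|\tr (M *m (coproj *m H *m (E^T *m E)))| <= k%:R * (h * s).
  have -> : \tr (M *m (coproj *m H *m (E^T *m E))) =
      \sum_(i < k) dot (row i (E *m H)) (row i (E *m M *m coproj)).
    rewrite (_ : _ *m _ = (M *m coproj *m H *m E^T) *m E); last by rewrite !mulmxA.
    rewrite mxtrace_mulC mulmxA trace_sum_rows; apply: eq_bigr => i _.
    by rewrite bf_dotl !mulmxA dot_mulmx Hs dotC !row_mul.
  apply: row_le => i; rewrite !row_mul.
    by apply: le_trans (bf_op h0 Hs Hh _) _; rewrite dot_row_orthonormal mulr1.
  apply: le_trans (dot_coproj_le _) _.
  by apply: le_trans (bf_op s0 Ms Mb _) _; rewrite dot_row_orthonormal mulr1.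
have -> : \tr (M *m H) - \tr (M *m (coproj *m H *m coproj)) =
    \tr (M *m (E^T *m E *m H)) + \tr (M *m (coproj *m H *m (E^T *m E))).
  rewrite -raddfB -raddfD -mulmxBr -mulmxDr; congr (\tr (M *m _)).
  rewrite {2}/coproj mulmxBr mulmx1 opprB addrA addrAC; congr (_ + _).
  by rewrite /coproj mulmxBl mul1mx opprB addrC subrK.
apply: le_trans (ler_normD _ _) _; apply: le_trans (lerD hP hQ) _.
by rewrite le_eqVlt; apply/orP; left; apply/eqP; ring.
Qed.

End Compression.

Lemma trace_mul_le n k (E : 'M[R]_(k, n)) (H M : 'M[R]_n) h s :
  E *m E^T = 1%:M -> psd (coproj E *m H *m coproj E) ->
  H^T = H -> M^T = M -> 0 <= h -> 0 <= s ->
  (forall u, `|bf H u u| <= h * dot u u) ->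
  (forall u, `|bf M u u| <= s * dot u u) ->
  `|\tr (M *m H)| <= s * (2 * k%:R * h + \tr (coproj E *m H *m coproj E)).
Proof.
move=> E1 Cp Hs Ms h0 s0 Hh Mb.
have := trace_mul_compress_le E1 Hs Ms h0 s0 Hh Mb.
have := trace_mul_psd Cp Mb.
set C := _ *m _ *m coproj E => t1 t2.
have := ler_normD (\tr (M *m H) - \tr (M *m C)) (\tr (M *m C)).
by rewrite subrK; move: t1 t2; lra.
Qed.

(** The supremum of |u M u^T| over the unit ball. The minimality clause turns a bound on the ball
    that itself involves h into a bound on h. *)
Lemma op_norm_exists n (M : 'M[R]_n) : exists h : R, [/\ 0 <= h,
  forall u, `|bf M u u| <= h * dot u u &
  forall b, (forall u, dot u u <= 1 -> `|bf M u u| <= b) -> h <= b].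
Proof.
set A := [set `|bf M u u| | u in [set u | dot u u <= 1]].
have A0 : A 0.
  by exists 0; rewrite /= /bf /dot ?mul0mx ?mxE ?normr0 ?ler01.
have ent_le (u : 'rV[R]_n) j : dot u u <= 1 -> `|u 0 j| <= 1.
  move=> u1; rewrite -(@ler_pXn2r _ 2) ?nnegrE // expr1n real_normK ?num_real //.
  apply: le_trans u1; rewrite dotE (bigD1 j) //= -expr2 lerDl.
  by apply: sumr_ge0 => i _; rewrite -expr2 sqr_ge0.
have hubA : has_ubound A.
  exists (\sum_j \sum_i `|M i j|) => _ [u u1 <-].
  rewrite /bf mxE; apply: le_trans (ler_norm_sum _ _ _) _; apply: ler_sum => j _.
  rewrite !mxE mulr_suml; apply: le_trans (ler_norm_sum _ _ _) _.
  apply: ler_sum => i _; rewrite !normrM -[leRHS]mulr1 -[X in X * 1]mul1r.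
  by rewrite ler_pM ?mulr_ge0 // ?ler_pM // ent_le.
have supA : has_sup A by split=> //; exists 0.
exists (sup A); split.
- exact: ub_le_sup.
- move=> u; have [u0|u0] := eqVneq (dot u u) 0.
    by rewrite u0 (dot_eq0 u0) /bf !mul0mx mxE normr0 mulr0.
  have up : 0 < dot u u by rewrite lt_neqAle eq_sym u0 dot_ge0.
  set c := Num.sqrt (dot u u).
  have cp : 0 < c by rewrite sqrtr_gt0.
  have c2 : c ^+ 2 = dot u u by rewrite sqr_sqrtr // ltW.
  have : `|bf M (c^-1 *: u) (c^-1 *: u)| <= sup A.
    apply: ub_le_sup => //; exists (c^-1 *: u) => //=.
    by rewrite dotZl dotZr mulrA -invfM -expr2 c2 mulVf.
  rewrite bfZl bfZr mulrA -invfM -expr2 c2 normrM gtr0_norm ?invr_gt0 //.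
  by rewrite ler_pdivrMl // mulrC.
- by move=> b hb; apply: ge_sup; [exists 0|move=> _ [u u1 <-]; exact: hb].
Qed.

(** By symmetry u M u^T - v M v^T = (u + v) M (u - v)^T. With |u + v| <= 2 and |u - v| <= 1/4 this
    is at most h / 2, so h <= s + h / 2. *)
Lemma net_bound n (V : 'rV[R]_n -> Prop) (M : 'M[R]_n) s :
  (forall u, dot u u <= 1 ->
    exists v, [/\ V v, dot v v <= 1 & dot (u - v) (u - v) <= 16^-1]) ->
  M^T = M -> (forall v, V v -> `|bf M v v| <= s) ->
  forall u, `|bf M u u| <= 2 * s * dot u u.
Proof.
move=> netV Ms Vs; have [h [h0 hM hmin]] := op_norm_exists M.
suff hs : h <= 2 * s.
  by move=> u; apply: le_trans (hM u) _; rewrite ler_wpM2r ?dot_ge0.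
suff : h <= s + h / 2 by lra.
apply: hmin => u u1; have [v [Vv v1 uv]] := netV u u1.
(* The factors 1/2 and 4 bring both vectors into the unit ball, where the additive bound of
   [bf_polar] loses nothing. *)
have -> : bf M u u = bf M v v + bf M (2^-1 *: (u + v)) (4 *: (u - v)) / 2.
  by rewrite bfZl bfZr !(bfDl, bfDr, bfNr) (bfC v u Ms); field.
apply: le_trans (ler_normD _ _) _; apply: lerD; first exact: Vs.
rewrite normrM [X in _ * X]gtr0_norm ?invr_gt0 // ler_pM2r ?invr_gt0 //.
apply: le_trans (bf_polar Ms hM _ _) _.
rewrite -[leRHS]mulr1 -mulrA ler_wpM2l // ler_pdivrMl // mulr1.
have uv4 : dot (u + v) (u + v) <= 4.
  have := dot_ge0 (u - v); rewrite !(dotDl, dotDr, dotNl, dotNr) (dotC v u).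
  by move: u1 v1; lra.
by rewrite !(dotZl, dotZr); lra.
Qed.

End RecoveryFromNet.

(** * Deterministic recovery *)

Section Recovery.
Variable R : realType.

Lemma frob_sqr n (H : 'M[R]_n) : H^T = H -> frob H ^+ 2 = \tr (H *m H).
Proof.
move=> Hs; rewrite /frob sqr_sqrtr; last first.
  by apply: sumr_ge0 => i _; apply: sumr_ge0 => j _; rewrite sqr_ge0.
apply: eq_bigr => i _; rewrite mxE; apply: eq_bigr => j _.
by rewrite expr2; congr (_ * _); rewrite -[in LHS]Hs mxE.
Qed.

(** [X0] is itself a competitor, so the differences of residuals sum to at most 0. On S the triangle
    inequality bounds the loss by |AH_i| whatever the outlier is; off S the residuals at [X0] and
    [Xh] are w_i and w_i - AH_i. *)
Lemma l1_minimizer_off_support m n (a : 'M[R]_(m, n)) (S : {set 'I_m})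
    (bet w : 'I_m -> R) (X0 Xh : 'M[R]_n) :
  psd X0 -> (forall i, i \notin S -> bet i = 0) ->
  is_l1_minimizer a (fun i => Aop a X0 i + bet i + w i) Xh ->
  \sum_i `|Aop a (Xh - X0) i| <=
    2 * (\sum_(i in S) `|Aop a (Xh - X0) i|) + 2 * l1norm w.
Proof.
move=> X0p bet0 [_ /(_ _ X0p)]; rewrite /l1norm => opt.
pose AH i := Aop a (Xh - X0) i.
have AHE i : Aop a Xh i = Aop a X0 i + AH i.
  by rewrite /AH /Aop mulmxBr mulmxBl !mxE subrKC.
have key i : `|AH i| <= (if i \in S then 2 * `|AH i| else 0) + 2 * `|w i| +
    (`|Aop a X0 i + bet i + w i - Aop a Xh i| -
     `|Aop a X0 i + bet i + w i - Aop a X0 i|).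
  rewrite AHE.
  have -> : Aop a X0 i + bet i + w i - (Aop a X0 i + AH i) = bet i + w i - AH i.
    by ring.
  have -> : Aop a X0 i + bet i + w i - Aop a X0 i = bet i + w i by ring.
  have := normr_ge0 (w i).
  case: ifPn => iS.
    have := lerB_normD (bet i + w i - AH i) (AH i).
    have := ler_normD (bet i + w i - AH i) (AH i); rewrite subrK; lra.
  rewrite bet0 // !add0r.
  have := ler_normB (w i) (w i - AH i); rewrite subKr; lra.
apply: le_trans (ler_sum _ (fun i _ => key i)) _.
rewrite !big_split /= sumrN -big_mkcond /= -!mulr_sumr.
by rewrite /AH; move: opt; lra.
Qed.

Definition netP n (V : 'rV[R]_n -> Prop) :=
  forall u, dot u u <= 1 ->
    exists v, [/\ V v, dot v v <= 1 & dot (u - v) (u - v) <= 16^-1].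

(* with N <= 34 r (F + 2 s N) and F <= 4 s N + 2 eps / m, the value 1 / (408 r) of s
   is the one for which the total coefficient 204 r s of N is 1/2 *)
Lemma recovery_of_net_concentration m n r (a : 'M[R]_(m, n)) (S : {set 'I_m})
    (V : 'rV[R]_n -> Prop) (al : 'rV[R]_n -> R)
    (bet w : 'I_m -> R) (X0 Xh : 'M[R]_n) eps :
  psd X0 -> \rank X0 = r -> (0 < r)%N -> (0 < m)%N -> l1norm w <= eps ->
  (forall i, i \notin S -> bet i = 0) ->
  netP V -> V 0 -> (forall v, V v -> 2^-1 <= al v) ->
  (forall u v, V u -> V v ->
    `|m%:R^-1 * (\sum_i cos (dot v (row i a)) * dot u (row i a) ^+ 2)
      - al v * (dot u u - dot u v ^+ 2)| <= (408 * r%:R)^-1) ->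
  (forall u, V u ->
    m%:R^-1 * (\sum_(i in S) dot u (row i a) ^+ 2) <= (408 * r%:R)^-1) ->
  is_l1_minimizer a (fun i => Aop a X0 i + bet i + w i) Xh ->
  frob (Xh - X0) <= 136 * r%:R * eps / m%:R.
Proof.
move=> X0p X0r r0 m0 weps bet0 netV V0 al_ge conc concS hmin.
have Xhp : psd Xh by case: hmin.
have := l1_minimizer_off_support X0p bet0 hmin.
set H := Xh - X0 => opt.
have [X0s X0ge] := (psdP X0).1 X0p; have [Xhs Xhge] := (psdP Xh).1 Xhp.
have Hs : H^T = H by rewrite linearB /= X0s Xhs.
have [k [E [E1 X0E EX0]]] := orthonormal_rows X0.
have kr : (k <= r)%N by rewrite -X0r -(orthonormal_rank E1) mxrankS.
have X0Q : X0 *m coproj E = 0.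
  have /submxP[D ->] := X0E.
  by rewrite /coproj mulmxBr mulmx1 !mulmxA -[D *m E *m _]mulmxA E1 mulmx1 subrr.
(* The projection kills [X0], so the compression of H is that of the feasible point [Xh]. *)
have Cp : psd (coproj E *m H *m coproj E).
  rewrite /H [coproj E *m (Xh - X0)]mulmxBr mulmxBl -[coproj E *m X0 *m _]mulmxA X0Q mulmx0 subr0.
  apply/psdP; split=> [|u]; first by rewrite !trmx_mul !coproj_sym Xhs mulmxA.
  have -> : bf (coproj E *m Xh *m coproj E) u u =
      bf Xh (u *m coproj E) (u *m coproj E).
    by rewrite /bf trmx_mul coproj_sym !mulmxA.
  exact: Xhge.
set C := _ *m _ *m _ in Cp.
have trC0 : 0 <= \tr C.
  have [l ->] := psd_gram Cp; rewrite -[X in \tr X]mulmx1 trace_gram.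
  by apply: sumr_ge0 => x _; rewrite bf1 dot_ge0.
have [h [h0 hH hmax]] := op_norm_exists H.
have rp : 0 < r%:R :> R by rewrite ltr0n.
have r1 : 1 <= r%:R :> R by rewrite ler1n.
have mp : 0 < m%:R :> R by rewrite ltr0n.
have krR : k%:R <= r%:R :> R by rewrite ler_nat.
set s := (408 * r%:R)^-1 in conc concS.
have sp : 0 < s by rewrite invr_gt0 mulr_gt0.
pose N := 2 * r%:R * h + \tr C.
have rh0 : 0 <= r%:R * h by rewrite mulr_ge0 // ltW.
have N0 : 0 <= N by rewrite addr_ge0 // -mulrA mulr_ge0.
have trM (M : 'M[R]_n) (t : R) : M^T = M -> 0 <= t ->
    (forall u, `|bf M u u| <= t * dot u u) -> `|\tr (M *m H)| <= t * N.
  move=> Ms t0 Mt; apply: le_trans (trace_mul_le E1 Cp Hs Ms h0 t0 hH Mt) _.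
  by rewrite ler_wpM2l // lerD2r -!mulrA ler_wpM2l // ler_wpM2r.
(* Duality with M = H: the squared Frobenius norm tr (H H) is at most h N, and h <= N since r >=
   1. *)
have frobN : frob H <= N.
  rewrite -(@ler_pXn2r _ 2) ?nnegrE ?sqrtr_ge0 // frob_sqr //.
  apply: le_trans (ler_norm _) _; apply: le_trans (trM H h Hs h0 hH) _.
  rewrite expr2 ler_wpM2r // /N.
  have : h <= r%:R * h by rewrite ler_peMl.
  by move: rh0 trC0; lra.
have outer_sym (x : 'rV[R]_n) : (x^T *m x)^T = x^T *m x.
  by rewrite trmx_mul trmxK.
have AE i : Aop a H i = bf H (row i a) (row i a) by [].
pose F := m%:R^-1 * \sum_i `|Aop a H i|.
have F0 : 0 <= F by apply: mulr_ge0; [rewrite invr_ge0 ltW|apply: sumr_ge0].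
pose G := F + 2 * s * N.
have G0 : 0 <= G by rewrite addr_ge0 // !mulr_ge0 // ltW.
have cosH v : V v -> `|al v * (\tr H - bf H v v)| <= G.
  move=> Vv.
  (* The deviation matrix of the weight of v: its form is at most s on the net, hence at most 2 s
     everywhere, and its trace against H compares the weighted measurements with their mean. *)
  pose M := m%:R^-1 *: (\sum_i cos (dot v (row i a)) *: ((row i a)^T *m row i a))
    - al v *: (1%:M - v^T *m v).
  have Ms : M^T = M.
    rewrite /M [LHS]raddfB /=; congr (_ - _).
      rewrite [LHS]linearZ raddf_sum; congr (_ *: _).
      by apply: eq_bigr => i _; rewrite [LHS]linearZ /= outer_sym.
    by rewrite [LHS]linearZ /= [X in _ *: X]raddfB /= trmx1 outer_sym.
  have Mq u : V u -> `|bf M u u| <= s.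
    move=> Vu; apply: le_trans (conc u v Vu Vv).
    rewrite /M !(bf_addmx, bf_oppmx, bf_scalemx) bf_sum bf1 bf_outer.
    rewrite (dotC v u) -expr2 le_eqVlt; apply/orP; left; apply/eqP.
    congr (`| _ * _ - _|); apply: eq_bigr => i _.
    by rewrite bf_scalemx bf_outer (dotC _ u) -expr2.
  have := trM M (2 * s) Ms _ (net_bound netV Ms Mq).
  move=> /(_ (mulr_ge0 (ler0n R 2) (ltW sp))).
  have -> : \tr (M *m H) = m%:R^-1 * (\sum_i cos (dot v (row i a)) * Aop a H i)
      - al v * (\tr H - bf H v v).
    rewrite /M mulmxBl raddfB /=; congr (_ - _).
      rewrite -scalemxAl mxtraceZ mulmx_suml raddf_sum; congr (_ * _).
      by apply: eq_bigr => i _; rewrite -scalemxAl /= mxtraceZ trace_outer.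
    by rewrite -scalemxAl mxtraceZ mulmxBl mul1mx raddfB /= trace_outer.
  have : `|m%:R^-1 * (\sum_i cos (dot v (row i a)) * Aop a H i)| <= F.
    rewrite normrM gtr0_norm ?invr_gt0 // ler_pM2l ?invr_gt0 //.
    apply: le_trans (ler_norm_sum _ _ _) _; apply: ler_sum => i _.
    by rewrite normrM ler_piMl // cos_max.
  set x := m%:R^-1 * _; set y := al v * _ => xF xy.
  have := ler_normB x (x - y); rewrite subKr /G; move: xF xy; lra.
have cosHV v : V v -> `|\tr H - bf H v v| <= 2 * G.
  move=> Vv; have := cosH v Vv; rewrite normrM => hv.
  have al2 : 2^-1 <= `|al v| by apply: le_trans (al_ge v Vv) (ler_norm _).
  have := ler_wpM2r (normr_ge0 (\tr H - bf H v v)) al2; move: hv; lra.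
have trH : `|\tr H| <= 2 * G.
  by have := cosHV 0 V0; rewrite /bf !mul0mx mxE subr0.
have hG : h <= 8 * G.
  have bV v : V v -> `|bf H v v| <= 4 * G.
    move=> Vv; have := ler_normB (\tr H) (\tr H - bf H v v); rewrite subKr.
    by have := cosHV v Vv; move: trH; lra.
  have := net_bound netV Hs bV => hb.
  apply: hmax => u u1; apply: le_trans (hb u) _.
  rewrite mulrA (_ : 2 * 4 = 8) -?natrM //.
  by rewrite -[leRHS]mulr1 ler_wpM2l // mulr_ge0.
(* The compression estimate for M = 1. *)
have trCH : \tr C <= `|\tr H| + 2 * r%:R * h.
  have one_bound (u : 'rV[R]_n) : `|bf 1%:M u u| <= 1 * dot u u.
    by rewrite bf1 mul1r ger0_norm // dot_ge0.
  have := trace_mul_compress_le E1 Hs (trmx1 _ _) h0 ler01 hH one_bound.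
  rewrite !mul1mx -/C mulr1 => t1.
  have : k%:R * h <= r%:R * h by rewrite ler_wpM2r.
  have := ler_norm (\tr H); move: t1; rewrite ler_norml => /andP[+ _].
  by lra.
(* Here 2 r h <= 16 r G and tr C <= 2 G + 16 r G, and G <= r G gives the total 34. *)
have NG : N <= 34 * r%:R * G.
  have : r%:R * h <= r%:R * (8 * G) by rewrite ler_wpM2l // ltW.
  have : G <= r%:R * G by rewrite ler_peMl.
  by rewrite /N; move: trCH trH; lra.
have FS : m%:R^-1 * (\sum_(i in S) `|Aop a H i|) <= 2 * s * N.
  (* The signs turn the sum of absolute values into a trace against one matrix. They depend on H,
     but the form of that matrix is dominated by the unsigned sum in [concS]. *)
  pose sgn i : R := Num.sg (Aop a H i).
  pose M := m%:R^-1 *: (\sum_(i in S) sgn i *: ((row i a)^T *m row i a)).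
  have Ms : M^T = M.
    rewrite /M [LHS]linearZ raddf_sum; congr (_ *: _).
    by apply: eq_bigr => i _; rewrite [LHS]linearZ /= outer_sym.
  have Mq u : V u -> `|bf M u u| <= s.
    move=> Vu; apply: le_trans (concS u Vu).
    rewrite bf_scalemx bf_sum normrM gtr0_norm ?invr_gt0 // ler_pM2l ?invr_gt0 //.
    apply: le_trans (ler_norm_sum _ _ _) _; apply: ler_sum => i _.
    rewrite bf_scalemx bf_outer (dotC _ u) -expr2 normrM.
    rewrite [X in _ * X]ger0_norm ?sqr_ge0 // ler_piMl ?sqr_ge0 //.
    by rewrite normr_sg; case: (_ == _).
  have := trM M (2 * s) Ms (mulr_ge0 (ler0n R 2) (ltW sp)) (net_bound netV Ms Mq).
  apply: le_trans; apply: le_trans (ler_norm _).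
  rewrite /M -scalemxAl mxtraceZ ler_pM2l ?invr_gt0 //.
  rewrite mulmx_suml raddf_sum; apply: ler_sum => i _.
  by rewrite -scalemxAl /= mxtraceZ trace_outer -AE normrEsg.
have Fopt : F <= 2 * (2 * s * N) + 2 * (eps / m%:R).
  rewrite /F; have : m%:R^-1 * (\sum_i `|Aop a H i|) <=
      m%:R^-1 * (2 * (\sum_(i in S) `|Aop a H i|) + 2 * l1norm w).
    by rewrite ler_pM2l ?invr_gt0.
  have : m%:R^-1 * l1norm w <= eps / m%:R.
    by rewrite mulrC ler_pM2r ?invr_gt0.
  by move: FS; lra.
have rs : r%:R * s = 408^-1.
  by rewrite /s invfM mulrCA mulfV ?gt_eqF // mulr1.
have : N <= 34 * r%:R * (2 * (eps / m%:R)) + 204 * (r%:R * s) * N.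
  apply: le_trans NG _.
  have : r%:R * G <= r%:R * (2 * (2 * s * N) + 2 * (eps / m%:R) + 2 * s * N).
    by rewrite ler_wpM2l ?(ltW rp) // /G lerD2r.
  by lra.
(* Half of N is absorbed, which doubles 34 * 2 into the constant 136. *)
rewrite rs => Nle; apply: le_trans frobN _.
by move: Nle; lra.
Qed.

End Recovery.

(** * Independence *)

Section IndependentFamilies.
Context d (T : measurableType d) (R : realType) (P : probability T R).
Variables (I : finType) (F : I -> set (set T)).
Hypothesis indF : indep_events P F.
Hypothesis FT : forall i, F i setT.
Hypothesis FI : forall i, setI_closed (F i).
Hypothesis Fm : forall i, F i `<=` measurable.

(** A pi-system generating the joint sigma-algebra of the families in [J]. Padding by [setT] outside
    [J] makes the product rule over all indices apply to each subfamily. *)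
Definition cylinders (J : pred I) : set (set T) :=
  [set A | exists E : I -> set T, [/\ forall i, F i (E i),
    forall i, ~~ J i -> E i = setT & A = [set t | forall i, E i t]]].

Definition sigma_of (J : pred I) : set (set T) := <<s cylinders J >>.

Lemma cylinders_measurable J : cylinders J `<=` measurable.
Proof.
move=> A [E [FE _ ->]].
rewrite (_ : [set t | forall i, E i t] = \bigcap_(i in [set: I]) E i).
  by apply: fin_bigcap_measurable => // i _; exact/Fm/FE.
by apply/seteqP; split=> t Et i //; exact: Et.
Qed.

Lemma cylinders_setI J : setI_closed (cylinders J).
Proof.
move=> _ _ [E1 [FE1 J1 ->]] [E2 [FE2 J2 ->]].
exists (fun i => E1 i `&` E2 i); split=> [i|i Ji|]; first exact: FI.
  by rewrite J1 // J2 // setIT.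
by apply/seteqP; split=> t /=; [case=> h1 h2 i|move=> h; split=> i; case: (h i)].
Qed.

Lemma cylinders_indep J K A B : (forall i, ~~ (J i && K i)) ->
  cylinders J A -> cylinders K B -> P (A `&` B) = (P A * P B)%E.
Proof.
move=> JK [E1 [FE1 J1 ->]] [E2 [FE2 J2 ->]].
rewrite (indF FE1) (indF FE2) -big_split /=.
have FE12 i : F i (E1 i `&` E2 i) by exact: FI.
rewrite (_ : _ `&` _ = [set t | forall i, (E1 i `&` E2 i) t]); last first.
  by apply/seteqP; split=> t /=; [case=> h1 h2 i|move=> h; split=> i; case: (h i)].
rewrite (indF FE12); apply: eq_bigr => i _.
have := JK i; rewrite negb_and => /orP[/J1|/J2] ->.
  by rewrite setTI probability_setT mul1e.
by rewrite setIT probability_setT mule1.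
Qed.

Lemma sigma_of_measurable J : sigma_of J `<=` measurable.
Proof.
apply: smallest_sub; last exact: cylinders_measurable.
exact: sigma_algebra_measurable.
Qed.

Lemma sub_sigma_of J K : subpred J K -> sigma_of J `<=` sigma_of K.
Proof.
move=> JK; apply: sub_sigma_algebra2 => A [E [FE J1 ->]].
by exists E; split=> // i Ki; apply: J1; apply: contra Ki; exact: JK.
Qed.

Lemma generator_sub_sigma_of (J : pred I) i : J i -> F i `<=` sigma_of J.
Proof.
move=> Ji A FA; apply: sub_sigma_algebra.
exists (fun j => if j == i then A else setT); split=> [j|j Jj|].
- by case: eqP => [->|].
- by case: eqP => // ji; move: Jj; rewrite ji Ji.
- apply/seteqP; split=> t /=; first by move=> At j; case: eqP.
  by move=> /(_ i); rewrite eqxx.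
Qed.

(** Dynkin's argument as uniqueness of measures: A |-> P (A and B) and A |-> P A * P B agree on the
    cylinders and have the same finite total mass. *)
Let pi_lambda J B : measurable B ->
  (forall A, cylinders J A -> P (A `&` B) = (P A * P B)%E) ->
  forall A, sigma_of J A -> P (A `&` B) = (P A * P B)%E.
Proof.
move=> mB AB A sA.
have PB0 : (0 <= fine (P B))%R by rewrite fine_ge0.
have PBE : P B = (fine (P B))%:E by rewrite fineK ?fin_num_measure.
pose m1 : {measure set T -> \bar R} := mrestr P mB.
pose m2 : {measure set T -> \bar R} := mscale (NngNum PB0) P.
have HE : [set X | cylinders J X /\ X `<=` setT] = cylinders J.
  by apply/seteqP; split=> X; [case|move=> ?; split].
suff : m1 A = m2 A.
  by rewrite /m1 /m2 /= /mscale /mrestr /= -PBE muleC.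
apply: (g_sigma_algebra_measure_unique_trace (cylinders J) setT) => //.
- by rewrite HE; exact: cylinders_measurable.
- by rewrite HE; exact: cylinders_setI.
- rewrite /m1 /m2 /= /mscale /mrestr /= -PBE setTI probability_setT.
  by rewrite mule1.
- move=> X [cX _]; rewrite /m1 /m2 /= /mscale /mrestr /= -PBE.
  by rewrite AB // muleC.
- by rewrite /m1 /= /mrestr setTI PBE ltry.
- by rewrite HE.
Qed.

(** The product rule is extended from cylinders to sigma-algebras one side at a time. *)
Lemma sigma_of_indep J K A B : (forall i, ~~ (J i && K i)) ->
  sigma_of J A -> sigma_of K B -> P (A `&` B) = (P A * P B)%E.
Proof.
move=> JK sA sB; apply: pi_lambda sA; first exact: sigma_of_measurable sB.
move=> C cC; rewrite setIC muleC.
apply: pi_lambda sB; first exact: cylinders_measurable cC.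
by move=> D cD; rewrite setIC muleC; exact: cylinders_indep cD.
Qed.

(** Retyping the domain by the generated sigma-algebra makes the closure lemmas for measurable
    functions available for sub-sigma-algebras. *)
Definition adapted (J : pred I) (f : T -> R) :=
  measurable_fun setT (f : g_sigma_algebraType (cylinders J) -> R).

Lemma adapted_measurable J f : adapted J f -> measurable_fun setT f.
Proof. by move=> Jf _ B mB; apply: (@sigma_of_measurable J); exact: Jf. Qed.

Lemma adapted_preimage J f B : adapted J f -> measurable B ->
  sigma_of J (f @^-1` B).
Proof. by move=> Jf mB; have := Jf measurableT B mB; rewrite setTI. Qed.

Lemma sub_adapted J K f : subpred J K -> adapted J f -> adapted K f.
Proof. by move=> JK Jf _ B mB; apply: (sub_sigma_of JK); exact: Jf. Qed.

Lemma adapted_generator (J : pred I) i (f : T -> R) : J i ->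
  events_of_real f `<=` F i -> adapted J f.
Proof.
move=> Ji fF _ B mB; rewrite setTI; apply: (generator_sub_sigma_of Ji).
by apply: fF; exists B.
Qed.

End IndependentFamilies.

(** * Calculus of means *)

Section Means.
Context d (T : measurableType d) (R : realType).
Implicit Types (P : probability T R) (f g : T -> R).

(** A relation carrying integrability together with the real value, so that sums, products and
    comparisons of means need no side conditions. *)
Definition mean_is P f (x : R) :=
  P.-integrable setT (EFin \o f) /\ (\int[P]_t (f t)%:E = x%:E)%E.

Lemma mean_is_measurable P f x : mean_is P f x -> measurable_fun setT f.
Proof. by case=> /measurable_int/measurable_EFinP. Qed.

Lemma mean_is_unique P f x y : mean_is P f x -> mean_is P f y -> x = y.
Proof. by move=> [_ fx] [_]; rewrite fx => -[]. Qed.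

Lemma eq_mean_is P f g x : f =1 g -> mean_is P f x -> mean_is P g x.
Proof. by move=> /funext ->. Qed.

Lemma mean_is_cst P c : mean_is P (fun=> c) c.
Proof.
split; last by rewrite integral_cst //= probability_setT mule1.
exact: (finite_measure_integrable_cst P c measurableT).
Qed.

Lemma mean_isD P f g x y : mean_is P f x -> mean_is P g y ->
  mean_is P (fun t => f t + g t) (x + y).
Proof.
move=> [fi fx] [gi gy]; split; last first.
  by under eq_integral do rewrite EFinD; rewrite integralD // fx gy.
rewrite (_ : _ \o _ = (EFin \o f) \+ (EFin \o g))%E //; exact: integrableD.
Qed.

Lemma mean_isZ P f c x : mean_is P f x -> mean_is P (fun t => c * f t) (c * x).
Proof.
move=> [fi fx]; split; last first.
  by under eq_integral do rewrite EFinM; rewrite integralZl // fx.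
rewrite (_ : _ \o _ = (fun t => c%:E * (EFin \o f) t))%E //; exact: integrableZl.
Qed.

Lemma mean_isB P f g x y : mean_is P f x -> mean_is P g y ->
  mean_is P (fun t => f t - g t) (x - y).
Proof.
move=> fx gy; rewrite -[- y]mulN1r; have := mean_isD fx (mean_isZ (-1) gy).
by apply: eq_mean_is => t; rewrite mulN1r.
Qed.

Lemma mean_is_sum P (J : Type) (s : seq J) (f : J -> T -> R) (x : J -> R) :
  (forall j, mean_is P (f j) (x j)) ->
  mean_is P (fun t => \sum_(j <- s) f j t) (\sum_(j <- s) x j).
Proof.
move=> fx; elim: s => [|j s IH].
  by rewrite big_nil; under eq_fun do rewrite big_nil; exact: mean_is_cst.
rewrite big_cons; under eq_fun do rewrite big_cons; exact: mean_isD.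
Qed.

Lemma le_mean_is P f g x y : (forall t, f t <= g t) ->
  mean_is P f x -> mean_is P g y -> x <= y.
Proof.
move=> fg [fi fx] [gi gy]; rewrite -lee_fin -fx -gy; apply: le_integral => //.
by move=> t _ /=; rewrite lee_fin.
Qed.

Lemma mean_is_dominated P f g y : measurable_fun setT f ->
  (forall t, `|f t| <= `|g t|) -> mean_is P g y -> exists x, mean_is P f x.
Proof.
move=> mf fg [gi gy].
have fi : P.-integrable setT (EFin \o f).
  apply: le_integrable gi => //; first exact/measurable_EFinP.
  by move=> t _ /=; rewrite lee_fin.
exists (fine (\int[P]_t (f t)%:E)%E); split=> //.
by rewrite fineK //; exact: integrable_fin_num.
Qed.

Lemma mean_is_ge0 P f (x : R) : measurable_fun setT f -> (forall t, 0 <= f t) ->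
  (\int[P]_t (f t)%:E = x%:E)%E -> mean_is P f x.
Proof.
move=> mf f0 fx; split=> //; apply/integrableP; split; first exact/measurable_EFinP.
by under eq_integral do rewrite /= ger0_norm //; rewrite fx ltry.
Qed.

Lemma ge0_mean_is_exists P f (b : R) : measurable_fun setT f -> (forall t, 0 <= f t) ->
  (\int[P]_t (f t)%:E <= b%:E)%E -> exists2 x, mean_is P f x & x <= b.
Proof.
move=> mf f0 fb.
have fE : (\int[P]_t (f t)%:E = (fine (\int[P]_t (f t)%:E))%:E)%E.
  rewrite fineK // ge0_fin_numE; first exact: le_lt_trans fb (ltry _).
  by apply: integral_ge0 => t _; rewrite lee_fin.
by exists (fine (\int[P]_t (f t)%:E))%E; [exact: mean_is_ge0|rewrite -lee_fin -fE].
Qed.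

End Means.

Section MeanTransfer.
Context d (T : measurableType d) d' (T' : measurableType d') (R : realType).

Lemma mean_is_law (P : probability T R) (Q : probability T' R) (X : T -> T')
    (phi : T' -> R) (x : R) : measurable_fun setT X ->
  (forall B, measurable B -> P (X @^-1` B) = Q B) ->
  mean_is Q phi x -> mean_is P (phi \o X) x.
Proof.
move=> mX XQ [phii phix].
have mphi : measurable_fun setT phi by apply/measurable_EFinP/measurable_int/phii.
have E (f : T' -> \bar R) : measurable_fun setT f -> (forall y, 0 <= f y)%E ->
    (\int[P]_t (f \o X) t = \int[Q]_y f y)%E.
  move=> mf f0; rewrite -[LHS](@ge0_integral_pushforward _ _ _ _ _ _ mX P setT f) //.
  apply: eq_measure_integral => A mA _; exact: XQ.
have inte : P.-integrable setT (EFin \o (phi \o X)).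
  apply/integrableP; split; first exact/measurable_EFinP/measurableT_comp.
  rewrite (E (fun y => `|(phi y)%:E|%E)) //; first by case/integrableP: phii.
  by apply: measurableT_comp => //; exact/measurable_EFinP.
split=> //; rewrite -phix.
rewrite -[LHS](@integral_pushforward _ _ _ _ _ _ mX P setT (EFin \o phi)) //.
  apply: eq_measure_integral => A mA _; exact: XQ.
exact/measurable_EFinP.
Qed.

End MeanTransfer.

(** * Mean of a product of independent variables *)

Section IndependentProducts.
Context d (T : measurableType d) (R : realType) (P : probability T R).
Implicit Types f g : T -> R.

Definition indep_rv f g := forall A B : set R, measurable A -> measurable B ->
  P (f @^-1` A `&` g @^-1` B) = (P (f @^-1` A) * P (g @^-1` B))%E.

Variables (f g : T -> R).
Hypotheses (mf : measurable_fun setT f) (mg : measurable_fun setT g).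
Hypothesis fg : indep_rv f g.

Let X : {RV P >-> R} := HB.pack f (isMeasurableFun.Build _ _ _ _ f mf).
Let Y : {RV P >-> R} := HB.pack g (isMeasurableFun.Build _ _ _ _ g mg).
Let mXY : measurable_fun setT (fun t => (f t, g t)).
Proof. exact: measurable_fun_pair. Qed.
Let XY : {RV P >-> (R * R)%type} :=
  HB.pack (fun t => (f t, g t)) (isMeasurableFun.Build _ _ _ _ _ mXY).

(** Independence is equality of the two laws on rectangles, which determines the product measure. *)
Let law_prod A : measurable A ->
  (distribution P X \x distribution P Y)%E A = distribution P XY A.
Proof.
apply: product_measure_unique => B C mB mC.
exact: fg.
Qed.

Lemma ge0_integral_indep (phi : R * R -> \bar R) : measurable_fun setT phi ->
  (forall z, 0 <= phi z)%E ->
  (\int[P]_t phi (f t, g t) = \int[P]_t \int[P]_s phi (f t, g s))%E.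
Proof.
move=> mphi phi0.
rewrite -[LHS](ge0_integral_distribution XY) //.
rewrite -(eq_measure_integral _ (fun A mA _ => law_prod mA)).
rewrite fubini_tonelli1 // ge0_integral_distribution //; last 2 first.
- exact: measurable_fun_fubini_tonelli_F.
- by move=> y; apply: integral_ge0.
apply: eq_integral => t _ /=; rewrite /fubini_F ge0_integral_distribution //.
exact: measurableT_comp.
Qed.

Let mmul : measurable_fun setT (fun z : R * R => z.1 * z.2).
Proof. exact: measurable_funM. Qed.

Lemma indep_integral_norm :
  (\int[P]_t `|f t * g t|%:E = \int[P]_t `|f t|%:E * \int[P]_t `|g t|%:E)%E.
Proof.
rewrite (@ge0_integral_indep (fun z => `|z.1 * z.2|%:E)) //; last first.
  by apply/measurable_EFinP; exact: measurableT_comp.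
have mnorm (h : T -> R) : measurable_fun setT h -> measurable_fun setT (fun t : T => `|h t|%:E).
  by move=> mh; apply/measurable_EFinP; exact: measurableT_comp.
transitivity (\int[P]_t (`|f t|%:E * \int[P]_s `|g s|%:E))%E.
  apply: eq_integral => t _; rewrite -ge0_integralZl //; last exact: mnorm.
  by apply: eq_integral => s _; rewrite normrM EFinM.
apply: ge0_integralZr => //; [exact: mnorm|exact: integral_ge0].
Qed.

Lemma mean_is_indep x y : mean_is P f x -> mean_is P g y ->
  mean_is P (fun t => f t * g t) (x * y).
Proof.
move=> [fi fx] [gi gy].
(* Tonelli for |f g| gives the integrability that Fubini requires for f g. *)
have fgi : P.-integrable setT (EFin \o (fun t => f t * g t)).
  apply/integrableP; split; first exact/measurable_EFinP/measurable_funM.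
  rewrite /= indep_integral_norm; move/integrableP : fi => [_ fi].
  move/integrableP : gi => [_ gi]; apply: lte_mul_pinfty => //.
    exact: integral_ge0.
  by rewrite ge0_fin_numE //; exact: integral_ge0.
split=> //.
pose phi (z : R * R) := (z.1 * z.2)%:E.
have mphi : measurable_fun setT phi by exact/measurable_EFinP.
rewrite -[LHS](integral_distribution (X := XY) mphi) //.
rewrite -(eq_measure_integral _ (fun A mA _ => law_prod mA)).
have phii : (distribution P X \x distribution P Y)%E.-integrable setT phi.
  have : (distribution P XY).-integrable setT phi.
    exact: (integrable_pushforward (phi := XY)).
  move=> /integrableP[_ h]; apply/integrableP; split=> //.
  by rewrite (eq_measure_integral _ (fun A mA _ => law_prod mA)).
rewrite -integral12_prod_meas1 // /fubini_F /phi /=.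
have mid : measurable_fun setT (EFin : R -> \bar R) by exact/measurable_EFinP.
have Xi : (distribution P X).-integrable setT EFin.
  exact: (integrable_pushforward (phi := X)).
have Yi : (distribution P Y).-integrable setT EFin.
  exact: (integrable_pushforward (phi := Y)).
under eq_integral => u _.
  under eq_integral do rewrite EFinM.
  rewrite integralZl // (integral_distribution (X := Y)) //= gy.
  over.
by rewrite integralZr // (integral_distribution (X := X)) //= fx.
Qed.

End IndependentProducts.

(** * Gaussian moments *)

Section StandardGaussian.
Variable R : realType.
Local Notation mu := (@lebesgue_measure R).
Local Notation gauss := (normal_prob (0 : R) 1).

(** The change of variables is in terms of the Radon-Nikodym derivative, which is almost everywhere
    the density because both have the same integral over every measurable set. *)
Lemma ge0_integral_normal (m s : R) (f : R -> \bar R) :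
  measurable_fun setT f -> (forall x, 0 <= f x)%E ->
  (\int[normal_prob m s]_x f x = \int[mu]_x (f x * (normal_pdf m s x)%:E))%E.
Proof.
move=> mf f0; have dom := normal_prob_dominates m s.
rewrite -(Radon_Nikodym_SigmaFinite.change_of_variables dom) //.
have mpdf : measurable_fun setT (EFin \o normal_pdf m s).
  by apply/measurable_EFinP; exact: measurable_normal_pdf.
apply: ae_eq_integral => //.
- apply: emeasurable_funM => //; apply: (measurable_int mu).
  exact: Radon_Nikodym_SigmaFinite.f_integrable.
- exact: emeasurable_funM.
- apply: ae_eqe_mul2l; apply: integral_ae_eq => //.
    exact: Radon_Nikodym_SigmaFinite.f_integrable.
  by move=> E _ mE; rewrite -Radon_Nikodym_SigmaFinite.f_integral.
Qed.

Lemma normal_pdf01 x : normal_pdf 0 1 x = normal_peak 1 * expR (- (x ^+ 2 / 2)) :> R.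
Proof.
by rewrite normal_pdfE ?oner_eq0 // /normal_fun subr0 expr1n mulNr.
Qed.

(** Completing the square gives exp (c^2 / 2) times the normal density centred at c. *)
Lemma mean_gauss_expR (c : R) : mean_is gauss (fun x => expR (c * x)) (expR (c ^+ 2 / 2)).
Proof.
have mexp : measurable_fun setT (fun x : R => expR (c * x)).
  by apply: measurableT_comp => //; exact: measurable_funM.
apply: mean_is_ge0 => //.
rewrite ge0_integral_normal; [|exact/measurable_EFinP|by move=> x; rewrite lee_fin expR_ge0].
transitivity (\int[mu]_x ((expR (c ^+ 2 / 2))%:E * (normal_pdf c 1 x)%:E))%E.
  apply: eq_integral => x _; rewrite -!EFinM; congr EFin.
  rewrite normal_pdf01 normal_pdfE ?oner_eq0 // /normal_fun.
  rewrite mulrCA [RHS]mulrCA -!expRD; congr (_ * expR _).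
  by rewrite expr1n; field.
rewrite ge0_integralZl ?integral_normal_pdf ?mule1 //.
  by apply/measurable_EFinP; exact: measurable_normal_pdf.
by move=> x _; rewrite lee_fin normal_pdf_ge0.
Qed.

(** Half of the Gaussian exponent survives: the integrand is sqrt 2 times the centred normal density
    of variance 2. *)
Lemma mean_gauss_expR_sqr :
  exists2 b : R, mean_is gauss (fun x => expR (x ^+ 2 / 4)) b & b <= 2.
Proof.
exists (Num.sqrt 2); last first.
  by rewrite -(@ler_pXn2r _ 2) ?nnegrE ?sqrtr_ge0 // sqr_sqrtr // expr2; lra.
have mexp : measurable_fun setT (fun x : R => expR (x ^+ 2 / 4)).
  by apply: measurableT_comp => //; apply: measurable_funM => //; exact: measurable_funX.
apply: mean_is_ge0 => //.
have s0 : Num.sqrt 2 != 0 :> R by rewrite sqrtr_eq0 -ltNge.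
rewrite ge0_integral_normal; [|exact/measurable_EFinP|by move=> x; rewrite lee_fin expR_ge0].
transitivity (\int[mu]_x ((Num.sqrt 2)%:E * (normal_pdf 0 (Num.sqrt (2 : R)) x)%:E))%E.
  apply: eq_integral => x _; rewrite -!EFinM; congr EFin.
  rewrite normal_pdf01 normal_pdfE // /normal_fun mulrCA -expRD mulrA.
  congr (_ * expR _); last by rewrite sqr_sqrtr // subr0; field.
  rewrite /normal_peak sqr_sqrtr // expr1n mul1r -mulrnAr sqrtrM // invfM mulrA.
  by rewrite mulfV // mul1r.
rewrite ge0_integralZl ?integral_normal_pdf ?mule1 //.
  by apply/measurable_EFinP; exact: measurable_normal_pdf.
by move=> x _; rewrite lee_fin normal_pdf_ge0.
Qed.

Lemma sqr_le_expR (x : R) : x ^+ 2 <= 4 * expR (x ^+ 2 / 4).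
Proof. by have := expR_ge1Dx (x ^+ 2 / 4); lra. Qed.


Lemma mean_is_gauss (f : R -> R) x : measurable_fun setT f ->
  mu.-integrable setT (fun x => (f x * normal_pdf 0 1 x)%:E) ->
  (\int[mu]_x (f x * normal_pdf 0 1 x)%:E = x%:E)%E -> mean_is gauss f x.
Proof.
move=> mf fi fx.
have fgi : gauss.-integrable setT (EFin \o f).
  apply/integrableP; split; first exact/measurable_EFinP.
  rewrite ge0_integral_normal //; last first.
    by apply: measurableT_comp => //; exact/measurable_EFinP.
  move/integrableP : fi => [_]; apply: le_lt_trans.
  rewrite le_eqVlt; apply/orP; left; apply/eqP; apply: eq_integral => y _ /=.
  by rewrite normrM EFinM [X in (_ * X%:E)%E]ger0_norm // normal_pdf_ge0.
split=> //; rewrite -fx integralE [RHS]integralE.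
have mEf : measurable_fun setT (EFin \o f) by exact/measurable_EFinP.
rewrite ge0_integral_normal //; last exact: measurable_funepos.
rewrite ge0_integral_normal //; last exact: measurable_funeneg.
congr (_ - _)%E; apply: eq_integral => y _.
  rewrite !funeposE /= -!EFin_max -EFinM maxr_pMl ?normal_pdf_ge0 //.
  by rewrite mul0r.
rewrite !funenegE /= -!EFin_max -EFinM maxr_pMl ?normal_pdf_ge0 //.
by rewrite mul0r mulNr.
Qed.

End StandardGaussian.

(** * Stein's identity for the standard Gaussian *)

Section Stein.
Import numFieldNormedType.Exports.
Variable R : realType.
Local Notation mu := (@lebesgue_measure R).
Local Notation gauss := (normal_prob (0 : R) 1).
Local Notation pdf := (normal_pdf (0 : R) 1).

Lemma is_derive_pdf (x : R) : is_derive x 1 pdf (- (x * pdf x)).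
Proof.
rewrite (_ : pdf = fun x => normal_peak 1 * expR (- (x ^+ 2 / 2))); last first.
  by apply/funext => y; rewrite normal_pdf01.
have H : is_derive x 1 (fun y : R => - (y ^+ 2 / 2)) (- x).
  have -> : (fun y : R => - (y ^+ 2 / 2)) = (fun y => (- 2^-1) *: (y ^+ 2)).
    by apply/funext => y; rewrite /GRing.scale /= mulNr mulrC.
  apply: is_derive_eq; rewrite /GRing.scale /=; by field.
have := @is_derive1_comp _ expR (fun y : R => - (y ^+ 2 / 2)) x _ _ (is_derive_expR _) H.
move=> H2; have := is_deriveZ (normal_peak (1 : R)) H2.
by move=> H3; apply: (is_derive_eq H3); rewrite /GRing.scale /=; ring.
Qed.

Lemma integrable_expR_sqr_pdf :
  mu.-integrable setT (fun x => (expR (x ^+ 2 / 4) * pdf x)%:E).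
Proof.
have [b [bi bE] _] := mean_gauss_expR_sqr R.
have mexp : measurable_fun setT (fun x : R => expR (x ^+ 2 / 4)).
  by apply: measurableT_comp => //; apply: measurable_funM => //; exact: measurable_funX.
apply/integrableP; split.
  by apply/measurable_EFinP/measurable_funM => //; exact: measurable_normal_pdf.
have : (\int[gauss]_x (expR (x ^+ 2 / 4))%:E < +oo)%E by rewrite bE ltry.
rewrite ge0_integral_normal; [|exact/measurable_EFinP|by move=> x; rewrite lee_fin expR_ge0].
apply: le_lt_trans; rewrite le_eqVlt; apply/orP; left; apply/eqP.
apply: eq_integral => x _ /=.
by rewrite ger0_norm ?EFinM // mulr_ge0 ?expR_ge0 ?normal_pdf_ge0.
Qed.

(** The integrand times the density is the derivative of F times the density. The fundamental
    theorem on growing intervals leaves boundary terms of order exp (- x^2 / 4), and the growth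
    allowed by K exp (x^2 / 4) is integrable against the density, which provides the dominating
    function. *)
Lemma gauss_stein (F dF : R -> R) (K : R) :
  (forall x : R, is_derive x 1 F (dF x)) -> continuous dF ->
  (forall x, `|F x| <= K * expR (x ^+ 2 / 4)) ->
  (forall x, `|dF x - x * F x| <= K * expR (x ^+ 2 / 4)) ->
  mean_is gauss (fun x => dF x - x * F x) 0.
Proof.
move=> F' cdF FK dFK.
have cF : continuous F.
  by move=> x; apply/differentiable_continuous/derivable1_diffP; have [] := F' x.
have cpdf : continuous pdf by apply: continuous_normal_pdf; exact: oner_neq0.
pose h x := dF x - x * F x.
have ch : continuous h.
  move=> x; apply: (@cvgB _ R^o); first exact: cdF.
  by apply: cvgM; [exact: cvg_id|exact: cF].
pose G x := F x * pdf x.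
have G' (x : R) : is_derive x 1 G (h x * pdf x).
  have := @is_deriveM R R F pdf x 1 _ _ (F' x) (is_derive_pdf x).
  by move=> H; apply: (is_derive_eq H); rewrite /GRing.scale /= /h; ring.
have cG : continuous G.
  by move=> x; apply/differentiable_continuous/derivable1_diffP; have [] := G' x.
have chp : continuous (fun x => h x * pdf x).
  by move=> x; apply: cvgM; [exact: ch|exact: cpdf].
have mh : measurable_fun setT h by exact: continuous_measurable_fun.
have mhp : measurable_fun setT (fun x => h x * pdf x).
  exact: continuous_measurable_fun.
have K0 : 0 <= K.
  have := le_trans (normr_ge0 _) (FK 0); rewrite expr0n mul0r expR0 mulr1.
  by [].
have gi : mu.-integrable setT (fun x => (K * (expR (x ^+ 2 / 4) * pdf x))%:E).
  have := integrableZl measurableT K integrable_expR_sqr_pdf.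
  by [].
(* The successor keeps the interval nondegenerate and lets the harmonic sequence bound the boundary
   terms. *)
pose D n : set R := `[- n.+1%:R, n.+1%:R]%classic.
pose f_ n := (EFin \o (fun x => h x * pdf x)) \_ (D n).
have mD n : measurable (D n) by exact: measurable_itv.
have fE n : (\int[mu]_x f_ n x = (G n.+1%:R - G (- n.+1%:R))%:E)%E.
  rewrite -integral_mkcond EFinB; apply: (@continuous_FTC2 _ (fun x => h x * pdf x) G).
  - by rewrite gtrN.
  - exact: continuous_subspaceT.
  - split.
    + by move=> x _; have [] := G' x.
    + by apply: cvg_at_right_filter; exact: cG.
    + by apply: cvg_at_left_filter; exact: cG.
  - by move=> x _; rewrite derive1E; have [_ ->] := G' x.
have [] := @dominated_convergence _ _ _ mu setT measurableT f_
  (EFin \o (fun x => h x * pdf x)) (fun x => (K * (expR (x ^+ 2 / 4) * pdf x))%:E).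
- move=> n; apply/(measurable_restrictT _ (mD n)).
  by apply: measurable_funTS; exact/measurable_EFinP.
- exact/measurable_EFinP.
- apply: aeW => x _; apply: cvg_near_cst; near=> n.
  rewrite /f_ patchE ifT //; apply/mem_set; rewrite /D /= in_itv /= -ler_norml.
  by rewrite (@le_trans _ _ n%:R) ?ler_nat //; near: n; exact: nbhs_infty_ger.
- exact: gi.
- apply: aeW => x n _.
  rewrite /f_ patchE; case: ifP => _ /=; last first.
    by rewrite normr0 lee_fin !mulr_ge0 ?expR_ge0 ?normal_pdf_ge0.
  rewrite lee_fin normrM [X in _ * X <= _]ger0_norm ?normal_pdf_ge0 // mulrA.
  by apply: ler_wpM2r; [exact: normal_pdf_ge0|exact: dFK].
move=> hpi _ lim; apply: mean_is_gauss => //.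
have GK x : `|G x| <= K * normal_peak 1 * expR (- (x ^+ 2 / 4)).
  rewrite normrM [X in _ * X <= _]ger0_norm ?normal_pdf_ge0 //.
  apply: le_trans (ler_wpM2r (normal_pdf_ge0 _ _ _) (FK x)) _.
  rewrite normal_pdf01 mulrCA -!mulrA -expRD le_eqVlt; apply/orP; left; apply/eqP.
  by rewrite mulrCA; congr (_ * (_ * expR _)); field.
have lim0 : (\int[mu]_x f_ n x)%E @[n --> \oo] --> (0 : R)%:E.
  apply: cvg_EFin; first by apply: nearW => n; rewrite fE.
  rewrite (_ : _ \o _ = fun n => G n.+1%:R - G (- n.+1%:R)); last first.
    by apply/funext => n /=; rewrite fE.
  pose C := 2 * (K * normal_peak 1 * 4).
  have Charm : (C * harmonic n) @[n --> \oo] --> (0 : R).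
    by rewrite -[X in _ --> X](mulr0 C); apply: cvgMr; exact: cvg_harmonic.
  apply/(@norm_cvg0P _ R^o); apply: squeeze_cvgr (cvg_cst _) Charm.
  apply: nearW => n; rewrite normr_ge0 /=; apply: le_trans (ler_normB _ _) _.
  apply: le_trans (lerD (GK _) (GK _)) _; rewrite sqrrN.
  have : expR (- (n.+1%:R ^+ 2 / 4)) <= 4 * n.+1%:R^-1 :> R.
    have -> : 4 * n.+1%:R^-1 = (n.+1%:R / 4)^-1 :> R by rewrite invf_div.
    rewrite expRN lef_pV2 ?posrE ?expR_gt0 ?divr_gt0 //.
    have := sqr_le_expR (n.+1%:R : R).
    have : n.+1%:R <= n.+1%:R ^+ 2 :> R by rewrite ler_eXnr // ler1n.
    by move=> h1 h2; rewrite ler_pdivrMr // mulrC; exact: le_trans h1 h2.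
  rewrite /C => /(ler_wpM2l (mulr_ge0 K0 (normal_peak_ge0 1))).
  by set e := expR _; set c := K * _; set y := n.+1%:R^-1; lra.
exact: (cvg_unique _ lim lim0).
Unshelve. all: by end_near.
Qed.

End Stein.

(** * Gaussian moments of x and x^2 against cos (v x) and sin (v x) *)

Section GaussianTrigonometricMoments.
Variables (R : realType) (v C S : R).
Import numFieldNormedType.Exports.
Local Notation gauss := (normal_prob (0 : R) 1).
Hypotheses (HC : mean_is gauss (fun x => cos (v * x)) C)
           (HS : mean_is gauss (fun x => sin (v * x)) S).

Let one_le (x : R) : 1 <= expR (x ^+ 2 / 4).
Proof. by rewrite -expR0 ler_expR divr_ge0 ?sqr_ge0. Qed.

Let norm_le (x : R) : `|x| <= 5 * expR (x ^+ 2 / 4).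
Proof.
have := sqr_le_expR x; have := one_le x; have := sqr_ge0 (`|x| - 1).
by rewrite sqrrB1 real_normK ?num_real // mulr2n; lra.
Qed.

Let is_derive_vx (x : R) : is_derive x 1 (fun y => v * y) v.
Proof.
have := is_deriveZ v (is_derive_id x (1 : R)).
by move=> H; apply: (is_derive_eq H); rewrite /GRing.scale /= mulr1.
Qed.

Let is_derive_sinv (x : R) : is_derive x 1 (fun y => sin (v * y)) (v * cos (v * x)).
Proof.
have := @is_derive1_comp R sin (fun y => v * y) x _ _ (is_derive_sin _) (is_derive_vx x).
by move=> H; apply: (is_derive_eq H); rewrite mulrC.
Qed.

Let is_derive_cosv (x : R) : is_derive x 1 (fun y => cos (v * y)) (- (v * sin (v * x))).
Proof.
have := @is_derive1_comp R cos (fun y => v * y) x _ _ (is_derive_cos _) (is_derive_vx x).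
by move=> H; apply: (is_derive_eq H); ring.
Qed.

Let continuous_of_derive (f df : R -> R) :
  (forall x : R, is_derive x 1 f (df x)) -> continuous f.
Proof.
by move=> H x; apply/differentiable_continuous/derivable1_diffP; have [] := H x.
Qed.

Let csinv := continuous_of_derive is_derive_sinv.
Let ccosv := continuous_of_derive is_derive_cosv.

Let cos1 x : `|cos (v * x)| <= 1. Proof. by rewrite cos_max. Qed.
Let sin1 x : `|sin (v * x)| <= 1. Proof. by rewrite sin_max. Qed.

(** Stein's identity for sin (v x). The three moments below come in the same way from cos (v x), x
    cos (v x) and x sin (v x), everything being expressed through C and S. *)
Lemma mean_gauss_mul_sin : mean_is gauss (fun x => x * sin (v * x)) (v * C).
Proof.
have H : mean_is gauss (fun x => v * cos (v * x) - x * sin (v * x)) 0.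
  (* The derivative contributes |v|, and the factor x contributes the 5 of [norm_le]. *)
  apply: (@gauss_stein _ _ _ (`|v| + 5)); first exact: is_derive_sinv.
  - by move=> x; apply: cvgM; [exact: cvg_cst|exact: ccosv].
  - move=> x; apply: le_trans (sin1 x) _; have := one_le x.
    by have := normr_ge0 v; nra.
  - move=> x; apply: le_trans (ler_normB _ _) _; rewrite !normrM.
    have := norm_le x; have := one_le x; have := cos1 x; have := sin1 x.
    have := normr_ge0 v; have := normr_ge0 x; nra.
have := mean_isB (mean_isZ v HC) H; rewrite subr0.
by apply: eq_mean_is => x; rewrite subKr.
Qed.

Lemma mean_gauss_mul_cos : mean_is gauss (fun x => x * cos (v * x)) (- (v * S)).
Proof.
have H : mean_is gauss (fun x => - (v * sin (v * x)) - x * cos (v * x)) 0.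
  apply: (@gauss_stein _ _ _ (`|v| + 5)); first exact: is_derive_cosv.
  - move=> x; apply: (@cvgN _ R^o); apply: cvgM; [exact: cvg_cst|exact: csinv].
  - move=> x; apply: le_trans (cos1 x) _; have := one_le x.
    by have := normr_ge0 v; nra.
  - move=> x; apply: le_trans (ler_normB _ _) _; rewrite normrN !normrM.
    have := norm_le x; have := one_le x; have := cos1 x; have := sin1 x.
    have := normr_ge0 v; have := normr_ge0 x; nra.
have := mean_isB (mean_isZ (- v) HS) H; rewrite subr0 mulNr.
by apply: eq_mean_is => x; rewrite mulNr subKr.
Qed.

Lemma mean_gauss_sqr_mul_cos :
  mean_is gauss (fun x => x ^+ 2 * cos (v * x)) ((1 - v ^+ 2) * C).
Proof.
have d (x : R) : is_derive x 1 (fun y => y * cos (v * y)) (cos (v * x) - v * (x * sin (v * x))).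
  have := is_deriveM (is_derive_id x (1 : R)) (is_derive_cosv x).
  by move=> H; apply: (is_derive_eq H); rewrite /GRing.scale /=; ring.
have H : mean_is gauss (fun x => (cos (v * x) - v * (x * sin (v * x))) - x * (x * cos (v * x))) 0.
  apply: (@gauss_stein _ (fun x => x * cos (v * x))
    (fun x => cos (v * x) - v * (x * sin (v * x))) (5 * `|v| + 5)).
  - move=> x; apply: (@cvgB _ R^o); first exact: ccosv.
    by apply: cvgM; [exact: cvg_cst|apply: cvgM; [exact: cvg_id|exact: csinv]].
  - move=> x; rewrite normrM.
    have := norm_le x; have := one_le x; have := cos1 x.
    have := normr_ge0 v; have := normr_ge0 x; have := normr_ge0 (cos (v * x)); nra.
  - move=> x; apply: le_trans (ler_normB _ _) _.
    apply: le_trans (lerD (ler_normB _ _) (lexx _)) _; rewrite !normrM.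
    have := norm_le x; have := one_le x; have := cos1 x; have := sin1 x.
    have := sqr_le_expR x; rewrite -(real_normK (num_real x)).
    have := normr_ge0 v; have := normr_ge0 x.
    set a := `|x|; set b := `|v|; set c := `|cos _|; set s := `|sin _|; set e := expR _.
    move=> a0 b0 ae s1 c1 e1 ae5.
    have h1 : b * (a * s) <= b * (5 * e).
      by rewrite ler_wpM2l //; apply: le_trans ae5; rewrite ler_piMr.
    have h2 : a * (a * c) <= a ^+ 2 by rewrite mulrA -expr2 ler_piMr ?sqr_ge0.
    by lra.
have := mean_isB (mean_isB HC (mean_isZ v mean_gauss_mul_sin)) H.
rewrite subr0 (_ : C - _ = (1 - v ^+ 2) * C); last by ring.
by apply: eq_mean_is => x; ring.
Qed.

Lemma mean_gauss_sqr_mul_sin :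
  mean_is gauss (fun x => x ^+ 2 * sin (v * x)) ((1 - v ^+ 2) * S).
Proof.
have d (x : R) : is_derive x 1 (fun y => y * sin (v * y)) (sin (v * x) + v * (x * cos (v * x))).
  have := is_deriveM (is_derive_id x (1 : R)) (is_derive_sinv x).
  by move=> H; apply: (is_derive_eq H); rewrite /GRing.scale /=; ring.
have H : mean_is gauss (fun x => (sin (v * x) + v * (x * cos (v * x))) - x * (x * sin (v * x))) 0.
  apply: (@gauss_stein _ (fun x => x * sin (v * x))
    (fun x => sin (v * x) + v * (x * cos (v * x))) (5 * `|v| + 5)).
  - move=> x; apply: (@cvgD _ R^o); first exact: csinv.
    by apply: cvgM; [exact: cvg_cst|apply: cvgM; [exact: cvg_id|exact: ccosv]].
  - move=> x; rewrite normrM.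
    have := norm_le x; have := one_le x; have := sin1 x.
    have := normr_ge0 v; have := normr_ge0 x; have := normr_ge0 (sin (v * x)); nra.
  - move=> x; apply: le_trans (ler_normB _ _) _.
    apply: le_trans (lerD (ler_normD _ _) (lexx _)) _; rewrite !normrM.
    have := norm_le x; have := one_le x; have := cos1 x; have := sin1 x.
    have := sqr_le_expR x; rewrite -(real_normK (num_real x)).
    have := normr_ge0 v; have := normr_ge0 x.
    set a := `|x|; set b := `|v|; set c := `|cos _|; set s := `|sin _|; set e := expR _.
    move=> a0 b0 ae s1 c1 e1 ae5.
    have h1 : b * (a * c) <= b * (5 * e).
      by rewrite ler_wpM2l //; apply: le_trans ae5; rewrite ler_piMr.
    have h2 : a * (a * s) <= a ^+ 2 by rewrite mulrA -expr2 ler_piMr ?sqr_ge0.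
    by lra.
have := mean_isB (mean_isD HS (mean_isZ v mean_gauss_mul_cos)) H.
rewrite subr0 (_ : S + _ = (1 - v ^+ 2) * S); last by ring.
by apply: eq_mean_is => x; ring.
Qed.

End GaussianTrigonometricMoments.

(** * Variables adapted to disjoint sets of indices *)

Section AdaptedVariables.
Context d (T : measurableType d) (R : realType) (P : probability T R).
Variables (I : finType) (F : I -> set (set T)).
Hypothesis indF : indep_events P F.
Hypothesis FT : forall i, F i setT.
Hypothesis FI : forall i, setI_closed (F i).
Hypothesis Fm : forall i, F i `<=` measurable.

Implicit Types (f g : T -> R) (J K : pred I).
Local Notation adapted := (@adapted d T R I F).

Lemma adapted_indep J K f g : (forall i, ~~ (J i && K i)) ->
  adapted J f -> adapted K g -> indep_rv P f g.
Proof.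
move=> JK Jf Kg A B mA mB; apply: (sigma_of_indep indF FI Fm JK).
  exact: adapted_preimage.
exact: adapted_preimage.
Qed.

Lemma adapted_cst J c : adapted J (fun=> c).
Proof. exact: measurable_cst. Qed.

Lemma adapted_comp J f (phi : R -> R) : measurable_fun setT phi ->
  adapted J f -> adapted J (fun t => phi (f t)).
Proof. by move=> mphi Jf; apply: (measurableT_comp mphi Jf). Qed.

Lemma adaptedD J f g : adapted J f -> adapted J g -> adapted J (fun t => f t + g t).
Proof. by move=> Jf Jg; apply: (measurable_funD Jf Jg). Qed.

Lemma adaptedM J f g : adapted J f -> adapted J g -> adapted J (fun t => f t * g t).
Proof. by move=> Jf Jg; apply: (measurable_funM Jf Jg). Qed.

Lemma adapted_sum J (K : Type) (s : seq K) (p : pred K) (f : K -> T -> R) :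
  (forall k, p k -> adapted J (f k)) -> adapted J (fun t => \sum_(k <- s | p k) f k t).
Proof.
move=> Jf; elim: s => [|k s IH].
  by under eq_fun do rewrite big_nil; exact: adapted_cst.
under eq_fun do rewrite big_cons.
by case pk: (p k) => //; apply: adaptedD => //; exact: Jf.
Qed.

Lemma mean_is_adaptedM J K f g x y : (forall i, ~~ (J i && K i)) ->
  adapted J f -> adapted K g -> mean_is P f x -> mean_is P g y ->
  mean_is P (fun t => f t * g t) (x * y).
Proof.
move=> JK Jf Kg fx gy; apply: mean_is_indep => //.
- exact: mean_is_measurable fx.
- exact: mean_is_measurable gy.
- exact: adapted_indep Kg.
Qed.

(** The induction also carries that the partial product is adapted to the union of the index sets
    met so far, hence independent of the next factor. *)
Lemma mean_is_prod (K : eqType) (s : seq K) (J : K -> pred I) (f : K -> T -> R)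
    (x : K -> R) : uniq s ->
  (forall k l i, k != l -> ~~ (J k i && J l i)) ->
  (forall k, adapted (J k) (f k)) -> (forall k, mean_is P (f k) (x k)) ->
  mean_is P (fun t => \prod_(k <- s) f k t) (\prod_(k <- s) x k).
Proof.
move=> + JJ Jf fx.
suff : uniq s -> adapted (fun i => has (J^~ i) s) (fun t => \prod_(k <- s) f k t) /\
    mean_is P (fun t => \prod_(k <- s) f k t) (\prod_(k <- s) x k).
  by move=> H /H[].
elim: s => [|k s IH] /=.
  move=> _; rewrite big_nil.
  rewrite (_ : (fun t => \prod_(k <- [::]) f k t) = fun=> 1); last by apply/funext => t; rewrite big_nil.
  by split; [exact: adapted_cst|exact: mean_is_cst].
move=> /andP[ks us]; have [As Ms] := IH us; rewrite big_cons.
rewrite (_ : (fun t => \prod_(j <- k :: s) f j t) = fun t => f k t * \prod_(k <- s) f k t); last first.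
  by apply/funext => t; rewrite big_cons.
split.
  apply: adaptedM; first by apply: sub_adapted (Jf k) => i Ji; rewrite Ji.
  by apply: sub_adapted As => i /= ->; rewrite orbT.
apply: mean_is_adaptedM (Jf k) As (fx k) Ms => i.
apply/negP => /andP[Jk /hasP[l ls Jl]].
have kl : k != l by apply: contraNneq ks => ->.
by have := JJ k l i kl; rewrite Jk Jl.
Qed.

End AdaptedVariables.

(** * Moments of linear forms of a Gaussian vector *)

Section GaussianVectorMoments.
Context d (T : measurableType d) (R : realType) (P : probability T R).
Variables (I : finType) (F : I -> set (set T)).
Hypothesis indF : indep_events P F.
Hypothesis FT : forall i, F i setT.
Hypothesis FI : forall i, setI_closed (F i).
Hypothesis Fm : forall i, F i `<=` measurable.
Variables (n : nat) (idx : 'I_n -> I) (X : T -> 'rV[R]_n).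
Hypothesis idx_inj : injective idx.
Hypothesis XF : forall j, events_of_real (fun t => X t 0 j) `<=` F (idx j).
Hypothesis Xm : forall j, measurable_fun setT (fun t => X t 0 j).
Hypothesis Xlaw : forall j (B : set R), measurable B ->
  P ((fun t => X t 0 j) @^-1` B) = normal_prob 0 1 B.

Local Notation gauss := (normal_prob (0 : R) 1).

Lemma mean_coord (phi : R -> R) x j : mean_is gauss phi x ->
  mean_is P (fun t => phi (X t 0 j)) x.
Proof.
move=> H; apply: (@mean_is_law _ _ _ _ _ P gauss (fun t => X t 0 j) phi x) => //.
  exact: Xm.
by move=> B mB; exact: Xlaw.
Qed.

Lemma adapted_coord j : adapted F (pred1 (idx j)) (fun t => X t 0 j).
Proof. by apply: (adapted_generator FT (i := idx j)); [exact: eqxx|exact: XF]. Qed.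

Definition partial_dot k (v : 'rV[R]_n) (x : 'rV[R]_n) : R :=
  \sum_(j | j != k) v 0 j * x 0 j.

Definition other_indices k : pred I := fun i => i \in [seq idx j | j <- enum 'I_n & j != k].

Lemma dot_split k v x : dot v x = v 0 k * x 0 k + partial_dot k v x.
Proof. by rewrite dotE (bigD1 k). Qed.

Lemma adapted_partial_dot k v : adapted F (other_indices k) (fun t => partial_dot k v (X t)).
Proof.
apply: adapted_sum => j jk; apply: adaptedM; first exact: adapted_cst.
apply: (sub_adapted (J := pred1 (idx j))); last exact: adapted_coord.
move=> i /= /eqP ->; rewrite /other_indices.
by apply: map_f; rewrite mem_filter jk mem_enum.
Qed.

Lemma other_indices_disj k i : ~~ (pred1 (idx k) i && other_indices k i).
Proof.
apply/negP => /andP[/= /eqP -> /mapP[j]]; rewrite mem_filter => /andP[+ _].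
by move=> /[swap] /idx_inj ->; rewrite eqxx.
Qed.

Lemma measurable_dot v : measurable_fun setT (fun t => dot v (X t)).
Proof.
under eq_fun do rewrite dotE.
by apply: measurable_sum => j; apply: measurable_funM.
Qed.

Lemma mean_expR_dot (v : 'rV[R]_n) (c : R) :
  mean_is P (fun t => expR (c * dot v (X t))) (expR (c ^+ 2 * dot v v / 2)).
Proof.
have -> : expR (c ^+ 2 * dot v v / 2) = \prod_(j < n) expR ((c * v 0 j) ^+ 2 / 2).
  rewrite -expR_sum dotE mulr_sumr mulr_suml; congr expR; apply: eq_bigr => j _.
  by rewrite exprMn -expr2.
have -> : (fun t => expR (c * dot v (X t))) =
    (fun t => \prod_(j < n) expR (c * v 0 j * X t 0 j)).
  apply/funext => t; rewrite -expR_sum dotE mulr_sumr; congr expR.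
  by apply: eq_bigr => j _; rewrite mulrA.
have mexp (b : R) : measurable_fun setT (fun x : R => expR (b * x)).
  by apply: measurableT_comp => //; exact: measurable_funM.
apply: (@mean_is_prod _ _ _ _ _ F indF FI Fm _ _ (fun j => pred1 (idx j))
  (fun j t => expR (c * v 0 j * X t 0 j))).
- exact: index_enum_uniq.
- move=> j l i jl; apply/negP => /andP[/= /eqP -> /eqP /idx_inj /eqP].
  by rewrite (negbTE jl).
- by move=> j; apply: (adapted_comp (mexp _)); exact: adapted_coord.
- by move=> j; apply: (mean_coord (phi := fun x => expR (c * v 0 j * x))); exact: mean_gauss_expR.
Qed.


(* exp (y^2/4) is the Gaussian mean of exp (y x / sqrt 2), which linearizes the
   exponent in the Gaussian vector *)
Lemma mean_expR_sqr_dot u : dot u u <= 1 ->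
  exists2 b : R, mean_is P (fun t => expR (dot u (X t) ^+ 2 / 4)) b & b <= 2.
Proof.
move=> u1; have [b [bi bE] b2] := mean_gauss_expR_sqr R.
have mexp : measurable_fun setT (fun x : R => expR (x ^+ 2 / 4)).
  by apply: measurableT_comp => //; apply: measurable_funM => //; exact: measurable_funX.
apply: ge0_mean_is_exists => //.
  by apply: (measurableT_comp mexp); exact: measurable_dot.
have s2 : Num.sqrt 2 ^+ 2 = 2 :> R by rewrite sqr_sqrtr.
pose f (z : T * R) := (expR (dot u (X z.1) / Num.sqrt 2 * z.2))%:E.
have mf : measurable_fun setT f.
  apply/measurable_EFinP; apply: measurableT_comp => //.
  apply: measurable_funM => //; apply: measurable_funM => //.
  by apply: (measurableT_comp (measurable_dot u)); exact: measurable_fst.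
have -> : (\int[P]_t (expR (dot u (X t) ^+ 2 / 4))%:E = \int[P]_t fubini_F gauss f t)%E.
  apply: eq_integral => t _; rewrite /fubini_F /f /= (mean_gauss_expR _).2.
  by rewrite expr_div_n s2; congr (expR _)%:E; field.
(* After the exchange the inner mean is exp (x^2 |u|^2 / 4), at most exp (x^2 / 4), whose Gaussian
   mean is at most 2. *)
rewrite (@fubini_tonelli _ _ _ _ _ P gauss f) //; last first.
  by move=> z; rewrite lee_fin expR_ge0.
apply: (@le_trans _ _ (\int[gauss]_x (expR (x ^+ 2 / 4))%:E)%E); last first.
  by rewrite bE lee_fin.
apply: ge0_le_integral => //.
- by move=> x _; apply: integral_ge0 => t _; rewrite lee_fin expR_ge0.
- by apply: measurable_fun_fubini_tonelli_G => // z; rewrite lee_fin expR_ge0.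
- exact/measurable_EFinP.
- move=> x _; rewrite /fubini_G /f /=.
  have := (mean_expR_dot u (x / Num.sqrt 2)).2.
  rewrite (_ : (fun t => _) = (fun t => (expR (dot u (X t) / Num.sqrt 2 * x))%:E)).
    move=> ->; rewrite lee_fin ler_expR expr_div_n s2 -mulrA.
    have := ler_wpM2l (sqr_ge0 x) u1; lra.
  by apply/funext => t; congr (expR _)%:E; ring.
Qed.

Lemma mean_bounded_exists (f : T -> R) : measurable_fun setT f -> (forall t, `|f t| <= 1) ->
  exists x : R, mean_is P f x.
Proof.
move=> mf f1; apply: (mean_is_dominated (g := fun=> 1) mf _ (mean_is_cst P 1)) => t.
by rewrite normr1.
Qed.

Let mcos : measurable_fun setT (@cos R).
Proof. exact: continuous_measurable_fun (@continuous_cos R). Qed.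

Let msin : measurable_fun setT (@sin R).
Proof. exact: continuous_measurable_fun (@continuous_sin R). Qed.

Lemma mean_cos_dot_exists v : exists c, mean_is P (fun t => cos (dot v (X t))) c.
Proof.
apply: mean_bounded_exists => [|t]; last exact: cos_max.
by apply: (measurableT_comp mcos); exact: measurable_dot.
Qed.

Lemma mean_coord_rest k (phi : R -> R) x g y : mean_is gauss phi x ->
  adapted F (other_indices k) g -> mean_is P g y ->
  mean_is P (fun t => phi (X t 0 k) * g t) (x * y).
Proof.
move=> phix gA gy.
have mphi : measurable_fun setT phi by exact: mean_is_measurable phix.
apply: (mean_is_adaptedM indF FI Fm (other_indices_disj k) _ gA _ gy).
  by apply: (adapted_comp mphi); exact: adapted_coord.
exact: mean_coord.
Qed.

Lemma mean_coord0 k : mean_is P (fun t => X t 0 k) 0.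
Proof.
have [S HS] : exists S, mean_is gauss (fun x : R => sin (0 * x)) S.
  by exists 0; under eq_fun do rewrite mul0r sin0; exact: mean_is_cst.
have := mean_coord k (mean_gauss_mul_cos HS); rewrite mul0r oppr0.
by apply: eq_mean_is => t /=; rewrite mul0r cos0 mulr1.
Qed.

Lemma mean_partial_dot_mul_exists k v (f : T -> R) : measurable_fun setT f ->
  (forall t, `|f t| <= 1) -> exists x, mean_is P (fun t => partial_dot k v (X t) * f t) x.
Proof.
move=> mf f1.
have HU : mean_is P (fun t => partial_dot k v (X t)) (\sum_(j | j != k) v 0 j * 0).
  rewrite /partial_dot -big_filter.
  rewrite (_ : (fun t => _) = (fun t => \sum_(j <- [seq j <- index_enum 'I_n | j != k])
      v 0 j * X t 0 j)); last by apply/funext => t; rewrite big_filter.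
  by apply: mean_is_sum => j; apply: mean_isZ; exact: mean_coord0.
apply: mean_is_dominated (HU) => [|t].
  by apply: measurable_funM => //; exact: mean_is_measurable HU.
by rewrite normrM ler_piMr.
Qed.

Section SplitCoordinate.
Variables (k : 'I_n) (v : 'rV[R]_n).
Let p := v 0 k.
Let W t := partial_dot k v (X t).

Let WA : adapted F (other_indices k) W. Proof. exact: adapted_partial_dot. Qed.
Let cosWA : adapted F (other_indices k) (fun t => cos (W t)).
Proof. exact: (adapted_comp mcos WA). Qed.
Let sinWA : adapted F (other_indices k) (fun t => sin (W t)).
Proof. exact: (adapted_comp msin WA). Qed.

Let mcosW : measurable_fun setT (fun t => cos (W t)).
Proof. exact: (adapted_measurable Fm cosWA). Qed.
Let msinW : measurable_fun setT (fun t => sin (W t)).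
Proof. exact: (adapted_measurable Fm sinWA). Qed.

Let cos1W t : `|cos (W t)| <= 1. Proof. exact: cos_max. Qed.
Let sin1W t : `|sin (W t)| <= 1. Proof. exact: sin_max. Qed.

Let gauss_bounded_exists (phi : R -> R) : measurable_fun setT phi ->
  (forall x, `|phi x| <= 1) -> exists y, mean_is gauss (fun x => phi (p * x)) y.
Proof.
move=> mphi phi1; apply: (mean_is_dominated (g := fun=> 1) _ _ (mean_is_cst gauss 1)).
  by apply: (measurableT_comp mphi); exact: measurable_funM.
by move=> x; rewrite normr1.
Qed.

Let cosE t : cos (dot v (X t)) =
  cos (p * X t 0 k) * cos (W t) - sin (p * X t 0 k) * sin (W t).
Proof. by rewrite (dot_split k) cosD. Qed.

Let sinE t : sin (dot v (X t)) =
  sin (p * X t 0 k) * cos (W t) + cos (p * X t 0 k) * sin (W t).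
Proof. by rewrite (dot_split k) sinD. Qed.

(* Gaussian integration by parts in the coordinate k, all other coordinates being
   gathered in W, which is independent of it *)
Lemma mean_coord_mul_sin_dot c : mean_is P (fun t => cos (dot v (X t))) c ->
  mean_is P (fun t => X t 0 k * sin (dot v (X t))) (p * c).
Proof.
move=> Hc.
have [C HC] := gauss_bounded_exists mcos (@cos_max R).
have [S HS] := gauss_bounded_exists msin (@sin_max R).
have [cW HcW] := mean_bounded_exists mcosW cos1W.
have [sW HsW] := mean_bounded_exists msinW sin1W.
have E1 := mean_isB (mean_coord_rest HC cosWA HcW) (mean_coord_rest HS sinWA HsW).
have -> : c = C * cW - S * sW.
  by apply: mean_is_unique Hc _; apply: eq_mean_is E1 => t; rewrite cosE.
have := mean_isD (mean_coord_rest (mean_gauss_mul_sin HC) cosWA HcW)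
  (mean_coord_rest (mean_gauss_mul_cos HS) sinWA HsW).
rewrite (_ : p * C * cW + - (p * S) * sW = p * (C * cW - S * sW)); last by rewrite /p; ring.
by apply: eq_mean_is => t /=; rewrite sinE; ring.
Qed.

(** Stein's identity E[X_k g(X)] = E[d_k g(X)] for g = (u . X) cos (v . X), whose k-th derivative is
    u_k cos (v . X) - v_k (u . X) sin (v . X). *)
Lemma mean_coord_mul_dot_cos_dot u c M :
  mean_is P (fun t => cos (dot v (X t))) c ->
  mean_is P (fun t => dot u (X t) * sin (dot v (X t))) M ->
  mean_is P (fun t => X t 0 k * (dot u (X t) * cos (dot v (X t)))) (u 0 k * c - p * M).
Proof.
move=> Hc HM; set q := u 0 k; pose U t := partial_dot k u (X t).
have UA : adapted F (other_indices k) U by exact: adapted_partial_dot.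
have [C HC] := gauss_bounded_exists mcos (@cos_max R).
have [S HS] := gauss_bounded_exists msin (@sin_max R).
have [cW HcW] := mean_bounded_exists mcosW cos1W.
have [sW HsW] := mean_bounded_exists msinW sin1W.
have [cU HcU] := mean_partial_dot_mul_exists k u mcosW cos1W.
have [sU HsU] := mean_partial_dot_mul_exists k u msinW sin1W.
have cUA := adaptedM UA cosWA; have sUA := adaptedM UA sinWA.
have Hxs := mean_gauss_mul_sin HC; have Hxc := mean_gauss_mul_cos HS.
have Hxxc := mean_gauss_sqr_mul_cos HC; have Hxxs := mean_gauss_sqr_mul_sin HS.
(* Uniqueness of means expands c and M in the one-dimensional moments and the means involving W; the
   claim is then a polynomial identity. *)
have cE : c = C * cW - S * sW.
  apply: mean_is_unique Hc _.
  have := mean_isB (mean_coord_rest HC cosWA HcW) (mean_coord_rest HS sinWA HsW).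
  by apply: eq_mean_is => t /=; rewrite cosE.
have ME : M = q * (p * C * cW + - (p * S) * sW) + (S * cU + C * sU).
  apply: mean_is_unique HM _.
  have := mean_isD
    (mean_isZ q (mean_isD (mean_coord_rest Hxs cosWA HcW) (mean_coord_rest Hxc sinWA HsW)))
    (mean_isD (mean_coord_rest HS cUA HcU) (mean_coord_rest HC sUA HsU)).
  by apply: eq_mean_is => t /=; rewrite sinE (dot_split k u) -/q -/(U t); ring.
have := mean_isD
  (mean_isZ q (mean_isB (mean_coord_rest Hxxc cosWA HcW) (mean_coord_rest Hxxs sinWA HsW)))
  (mean_isB (mean_coord_rest Hxc cUA HcU) (mean_coord_rest Hxs sUA HsU)).
rewrite (_ : q * ((1 - p ^+ 2) * C * cW - (1 - p ^+ 2) * S * sW) +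
  (- (p * S) * cU - p * C * sU) = q * c - p * M); last by rewrite cE ME /q /p; ring.
by apply: eq_mean_is => t /=; rewrite cosE (dot_split k u) -/q -/(U t); ring.
Qed.

End SplitCoordinate.

(** Integration by parts, summed over coordinates with weights u_k: once it gives (u . v) c for the
    sine, twice the stated value for the cosine. *)
Lemma mean_sqr_dot_mul_cos_dot u v c : mean_is P (fun t => cos (dot v (X t))) c ->
  mean_is P (fun t => cos (dot v (X t)) * dot u (X t) ^+ 2)
    (c * (dot u u - dot u v ^+ 2)).
Proof.
move=> Hc.
have HM : mean_is P (fun t => dot u (X t) * sin (dot v (X t))) (dot u v * c).
  rewrite dotE mulr_suml.
  have := mean_is_sum (index_enum 'I_n)
    (fun j => mean_isZ (u 0 j) (mean_coord_mul_sin_dot j Hc)).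
  rewrite (eq_bigr (fun j => u 0 j * v 0 j * c)) => [|j _]; last by rewrite mulrA.
  apply: eq_mean_is => t /=; rewrite [dot u (X t)]dotE mulr_suml.
  by apply: eq_bigr => j _; rewrite mulrA.
have -> : c * (dot u u - dot u v ^+ 2) =
    \sum_(k < n) u 0 k * (u 0 k * c - v 0 k * (dot u v * c)).
  have -> : \sum_(k < n) u 0 k * (u 0 k * c - v 0 k * (dot u v * c)) =
      c * (\sum_(k < n) u 0 k * u 0 k) - dot u v * c * (\sum_(k < n) u 0 k * v 0 k).
    by rewrite !mulr_sumr -sumrB; apply: eq_bigr => k _; ring.
  by rewrite -!dotE; ring.
have := mean_is_sum (index_enum 'I_n)
  (fun k => mean_isZ (u 0 k) (mean_coord_mul_dot_cos_dot k Hc HM)).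
apply: eq_mean_is => t.
rewrite (eq_bigr (fun k => (dot u (X t) * cos (dot v (X t))) * (u 0 k * X t 0 k))); last first.
  by move=> k _; ring.
by rewrite -mulr_sumr -dotE; ring.
Qed.

Lemma mean_sqr_dot u : mean_is P (fun t => dot u (X t) ^+ 2) (dot u u).
Proof.
have H0 : mean_is P (fun t => cos (dot 0 (X t))) 1.
  apply: eq_mean_is (mean_is_cst P 1) => t.
  by rewrite /dot mul0mx mxE cos0.
have := mean_sqr_dot_mul_cos_dot u H0.
rewrite mul1r (_ : dot u 0 = 0) ?expr0n ?subr0; last by rewrite /dot trmx0 mulmx0 mxE.
by apply: eq_mean_is => t /=; rewrite /dot mul0mx mxE cos0 mul1r.
Qed.

End GaussianVectorMoments.

(** * Concentration *)

Section ElementaryBounds.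
Import numFieldNormedType.Exports.
Variable R : realType.
Implicit Types x z s : R.

(** A second-order Taylor bound for both signs of z, drawn from 1 + z <= exp z alone. *)
Lemma expR_le_quadratic z : expR z <= 1 + z + z ^+ 2 * expR `|z|.
Proof.
have h1 : expR z - 1 <= z * expR z.
  have := expR_ge1Dx (- z); rewrite expRN => h.
  have := ler_wpM2r (expR_ge0 z) h; rewrite mulVf ?gt_eqF ?expR_gt0 //; lra.
have h2 := expR_ge1Dx z.
have [z0|z0] := leP 0 z.
  rewrite ger0_norm //.
  have : z * (expR z - 1) <= z * (z * expR z) by rewrite ler_wpM2l.
  by rewrite expr2; lra.
rewrite ltr0_norm //.
have e1 : 1 <= expR (- z) by rewrite -expR0 ler_expR; lra.
have : - z * (1 - expR z) <= - z * - z by rewrite ler_wpM2l //; lra.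
have : z ^+ 2 * 1 <= z ^+ 2 * expR (- z) by rewrite ler_wpM2l // sqr_ge0.
rewrite expr2; lra.
Qed.

Lemma sqr_le_expR_div8 s : 0 <= s -> s ^+ 2 <= 256 * expR (s / 8).
Proof.
move=> s0; have -> : s / 8 = s / 16 + s / 16 by field.
rewrite expRD; have := expR_ge1Dx (s / 16); set e := expR _ => h.
have : (s / 16) * (s / 16) <= e * e.
  by apply: ler_pM; rewrite ?divr_ge0 //; lra.
rewrite expr2; lra.
Qed.

Lemma normr_sin_le x : `|sin x| <= `|x|.
Proof.
wlog x0 : x / 0 <= x.
  move=> H; have [/H//|/ltW x0] := leP 0 x.
  by rewrite -normrN -sinN -[leRHS]normrN; apply: H; rewrite oppr_ge0.
have [->|xn] := eqVneq x 0; first by rewrite sin0.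
have xp : 0 < x by rewrite lt_neqAle eq_sym xn.
have [|c _] := @MVT R sin cos 0 x xp (fun y _ => is_derive_sin y).
  by apply: continuous_subspaceT; exact: continuous_sin.
rewrite sin0 !subr0 => ->; rewrite normrM ler_piMl //; exact: cos_max.
Qed.

Lemma cos_ge_quadratic x : 1 - x ^+ 2 / 2 <= cos x.
Proof.
have -> : cos x = 1 - 2 * sin (x / 2) ^+ 2.
  have {1}-> : x = (x / 2) *+ 2 by rewrite -mulr_natr divfK.
  by rewrite cos_mulr2n -mulr_natr cos2sin2; ring.
have : sin (x / 2) ^+ 2 <= (x / 2) ^+ 2.
  rewrite -[leLHS]real_normK ?num_real // -[leRHS]real_normK ?num_real //.
  by rewrite ler_pXn2r ?nnegrE // normr_sin_le.
rewrite exprMn; lra.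
Qed.

End ElementaryBounds.

(** * Exponential moments and the Chernoff bound *)

Section Chernoff.
Context d (T : measurableType d) (R : realType) (P : probability T R).

(** The moment exp (Y / 4) is split in halves: one absorbs Z^2 at the cost 256, the other exp |tau
    Z| since |tau| <= 1/8. With b <= 2 this gives 512. *)
Lemma mgf_subexponential (Z Y : T -> R) mu tau b :
  (forall t, `|Z t| <= Y t) -> mean_is P Z mu ->
  mean_is P (fun t => expR (Y t / 4)) b -> b <= 2 -> `|tau| <= 8^-1 ->
  exists2 x, mean_is P (fun t => expR (tau * Z t)) x &
    x <= expR (tau * mu + 512 * tau ^+ 2).
Proof.
move=> ZY HZ HY b2 tau8.
have mZ := mean_is_measurable HZ.
have Hb := mean_isD (mean_isD (mean_is_cst P 1) (mean_isZ tau HZ))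
  (mean_isZ (256 * tau ^+ 2) HY).
have bound t : expR (tau * Z t) <= 1 + tau * Z t + 256 * tau ^+ 2 * expR (Y t / 4).
  have Y0 : 0 <= Y t by apply: le_trans (ZY t).
  apply: le_trans (expR_le_quadratic _) _; rewrite lerD2l exprMn.
  suff hz : Z t ^+ 2 * expR `|tau * Z t| <= 256 * expR (Y t / 4).
    by have := ler_wpM2l (sqr_ge0 tau) hz; lra.
  have -> : Y t / 4 = Y t / 8 + Y t / 8 by field.
  rewrite expRD mulrA; apply: ler_pM; rewrite ?expR_ge0 ?sqr_ge0 //; last first.
    by rewrite ler_expR normrM mulrC; apply: ler_pM.
  apply: le_trans (sqr_le_expR_div8 Y0).
  by rewrite -[leLHS]real_normK ?num_real // ler_pXn2r ?nnegrE.
have [x Hx] : exists x, mean_is P (fun t => expR (tau * Z t)) x.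
  apply: mean_is_dominated (Hb) => [|t].
    by apply: measurableT_comp => //; exact: measurable_funM.
  by rewrite ger0_norm ?expR_ge0 // (le_trans (bound t)) // ler_norm.
exists x => //; have := le_mean_is bound Hx Hb.
have := expR_ge1Dx (tau * mu + 512 * tau ^+ 2).
have : 256 * tau ^+ 2 * b <= 256 * tau ^+ 2 * 2 by rewrite ler_wpM2l // mulr_ge0 ?sqr_ge0.
lra.
Qed.

Lemma prob_gt_le_mean (W : T -> R) (x L : R) : mean_is P (fun t => expR (W t)) x ->
  measurable_fun setT W -> (P [set t | (L < W t)%R] <= (expR (- L) * x)%:E)%E.
Proof.
move=> HW mW.
have mA : measurable [set t | L < W t].
  rewrite (_ : [set _ | _] = W @^-1` `]L, +oo[%classic); last first.
    by apply/seteqP; split=> t /=; rewrite in_itv /= andbT.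
  by rewrite -[X in measurable X]setTI; apply: mW => //; exact: measurable_itv.
have [Hi <-] := mean_isZ (expR (- L)) HW.
rewrite -[X in P X]setIT -integral_indic //; apply: ge0_le_integral => //.
- by apply/measurable_EFinP; exact: measurable_indic.
- exact: (measurable_int P Hi).
- move=> t _; rewrite lee_fin indicE -expRD.
  have [|_] := boolP (t \in _); last by rewrite expR_ge0.
  by rewrite inE /= => LW; rewrite -expR0 ler_expR; lra.
Qed.

End Chernoff.

(** * Tail bounds for the rows of the Gaussian matrix *)

Section GaussianMatrix.
Context d (T : measurableType d) (R : realType) (P : probability T R).
Variables (m n : nat) (a : T -> 'M[R]_(m, n)).
Variable F : option ('I_m * 'I_n) -> set (set T).
Hypothesis indF : indep_events P F.
Hypothesis FT : forall i, F i setT.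
Hypothesis FI : forall i, setI_closed (F i).
Hypothesis Fm : forall i, F i `<=` measurable.
Hypothesis aF : forall i j, events_of_real (fun t => a t i j) `<=` F (Some (i, j)).
Hypothesis am : forall i j, measurable_fun setT (fun t => a t i j).
Hypothesis alaw : forall i j (B : set R), measurable B ->
  P ((fun t => a t i j) @^-1` B) = normal_prob 0 1 B.

Let entry i j : (fun t => row i (a t) 0 j) = (fun t => a t i j).
Proof. by apply/funext => t; rewrite mxE. Qed.

Let rowF i j : events_of_real (fun t => row i (a t) 0 j) `<=` F (Some (i, j)).
Proof. by rewrite entry. Qed.

Let rowm i j : measurable_fun setT (fun t => row i (a t) 0 j).
Proof. by rewrite entry. Qed.

Let rowlaw i j (B : set R) : measurable B ->
  P ((fun t => row i (a t) 0 j) @^-1` B) = normal_prob 0 1 B.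
Proof. by rewrite entry; exact: alaw. Qed.

Let idx_inj i : injective (fun j : 'I_n => Some (i, j) : option ('I_m * 'I_n)).
Proof. by move=> j k []. Qed.

Definition row_indices i : pred (option ('I_m * 'I_n)) :=
  fun o => if o is Some ij then ij.1 == i else false.

Lemma row_indices_disj i k o : i != k -> ~~ (row_indices i o && row_indices k o).
Proof.
move=> ik; case: o => [[i' j]|] //=; apply/negP => /andP[/eqP -> /eqP].
exact/eqP.
Qed.

Lemma adapted_row_dot i v : adapted F (row_indices i) (fun t => dot v (row i (a t))).
Proof.
under eq_fun do rewrite dotE; apply: adapted_sum => j _.
apply: adaptedM; first exact: adapted_cst.
by apply: (adapted_generator FT (i := Some (i, j))) => //=.
Qed.

Lemma mean_expR_sqr_row i u : dot u u <= 1 ->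
  exists2 b : R, mean_is P (fun t => expR (dot u (row i (a t)) ^+ 2 / 4)) b & b <= 2.
Proof.
exact: (@mean_expR_sqr_dot _ _ _ P _ F indF FT FI Fm n
  (fun j => Some (i, j)) (fun t => row i (a t)) (@idx_inj i) (@rowF i) (@rowm i) (@rowlaw i)).
Qed.

(** The characteristic function of row i at v, kept as an integral and so indexed by i; [mean_alpha]
    averages it over the rows. *)
Definition mean_cos i v : R := (\int[P]_t cos (dot v (row i (a t))))%R.

Lemma mean_is_mean_cos i v :
  mean_is P (fun t => cos (dot v (row i (a t)))) (mean_cos i v).
Proof.
have [c Hc] := @mean_cos_dot_exists _ _ _ P _ (fun t => row i (a t)) (rowm i) v.
suff -> : mean_cos i v = c by [].
by rewrite /mean_cos /Rintegral Hc.2.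
Qed.

(** Take means in cos x >= 1 - x^2 / 2; the variance of v . a_i is |v|^2 <= 1. *)
Lemma mean_cos_ge i v : dot v v <= 1 -> 2^-1 <= mean_cos i v.
Proof.
move=> v1.
have := @mean_sqr_dot _ _ _ P _ F indF FT FI Fm n
  (fun j => Some (i, j)) (fun t => row i (a t)) (@idx_inj i) (@rowF i) (@rowm i) (@rowlaw i) v.
move=> /(mean_isZ 2^-1) /(mean_isB (mean_is_cst P 1)) H.
suff : 1 - 2^-1 * dot v v <= mean_cos i v by move: v1; lra.
apply: le_mean_is H (mean_is_mean_cos i v) => t.
by have := cos_ge_quadratic (dot v (row i (a t))); lra.
Qed.

Lemma mean_cos_sqr_row i u v :
  mean_is P (fun t => cos (dot v (row i (a t))) * dot u (row i (a t)) ^+ 2)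
    (mean_cos i v * (dot u u - dot u v ^+ 2)).
Proof.
exact: (@mean_sqr_dot_mul_cos_dot _ _ _ P _ F indF FT FI Fm n
  (fun j => Some (i, j)) (fun t => row i (a t)) (@idx_inj i) (@rowF i) (@rowm i) (@rowlaw i) u v _ (mean_is_mean_cos i v)).
Qed.

Let msqr : measurable_fun setT (fun x : R => x ^+ 2).
Proof. exact: measurable_funX. Qed.

Let mcos : measurable_fun setT (@cos R).
Proof. exact: continuous_measurable_fun (@continuous_cos R). Qed.

Lemma adapted_cos_sqr_row i u v :
  adapted F (row_indices i) (fun t => cos (dot v (row i (a t))) * dot u (row i (a t)) ^+ 2).
Proof.
apply: adaptedM.
  exact: (adapted_comp mcos (@adapted_row_dot i v)).
exact: (adapted_comp msqr (@adapted_row_dot i u)).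
Qed.

Let mexpR_scale (c : R) : measurable_fun setT (fun x : R => expR (c * x)).
Proof. by apply: measurableT_comp => //; exact: measurable_funM. Qed.

Definition cos_sqr_sum u v t : R :=
  \sum_i cos (dot v (row i (a t))) * dot u (row i (a t)) ^+ 2.

Definition cos_sqr_mean u v : R :=
  \sum_i mean_cos i v * (dot u u - dot u v ^+ 2).

Lemma measurable_cos_sqr_sum u v : measurable_fun setT (cos_sqr_sum u v).
Proof.
apply: measurable_sum => i; exact: (adapted_measurable Fm (@adapted_cos_sqr_row i u v)).
Qed.

(** Independent rows multiply their exponential moments. A signed [tau] covers both tails. *)
Lemma cos_sqr_tail u v (tau L : R) : dot u u <= 1 -> `|tau| <= 8^-1 ->
  (P [set t | (tau * cos_sqr_mean u v + L < tau * cos_sqr_sum u v t)%R] <=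
    (expR (- L + 512 * tau ^+ 2 * m%:R))%:E)%E.
Proof.
move=> u1 tau8.
have mgf i : exists x, mean_is P (fun t => expR (tau * (cos (dot v (row i (a t))) *
      dot u (row i (a t)) ^+ 2))) x /\
    x <= expR (tau * (mean_cos i v * (dot u u - dot u v ^+ 2)) + 512 * tau ^+ 2).
  have [b Hb b2] := mean_expR_sqr_row i u1.
  have [|x Hx xle] := mgf_subexponential _ (mean_cos_sqr_row i u v) Hb b2 tau8.
    move=> t; rewrite normrM [X in _ * X]ger0_norm ?sqr_ge0 //.
    by rewrite ler_piMl ?sqr_ge0 // cos_max.
  by exists x.
have [x Hx] := choice mgf.
have Hprod := mean_is_prod indF FI Fm (index_enum_uniq 'I_m)
  (fun i k o ik => row_indices_disj o ik)
  (fun i => adapted_comp (mexpR_scale tau) (@adapted_cos_sqr_row i u v))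
  (fun i => (Hx i).1).
have {}Hprod : mean_is P (fun t => expR (tau * cos_sqr_sum u v t)) (\prod_i x i).
  by apply: eq_mean_is Hprod => t; rewrite -expR_sum -mulr_sumr.
apply: le_trans (prob_gt_le_mean _ Hprod _) _.
  by apply: measurable_funM => //; exact: measurable_cos_sqr_sum.
rewrite lee_fin.
apply: (@le_trans _ _ (expR (- (tau * cos_sqr_mean u v + L)) *
    expR (tau * cos_sqr_mean u v + 512 * tau ^+ 2 * m%:R))); last first.
  by rewrite -expRD ler_expR; lra.
rewrite ler_wpM2l ?expR_ge0 //.
have -> : tau * cos_sqr_mean u v + 512 * tau ^+ 2 * m%:R =
    \sum_i (tau * (mean_cos i v * (dot u u - dot u v ^+ 2)) + 512 * tau ^+ 2).
  by rewrite big_split /= -mulr_sumr sumr_const card_ord mulr_natr.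
rewrite expR_sum; apply: ler_prod => i _; rewrite (Hx i).2 andbT.
by apply: le_mean_is (mean_is_cst P 0) (Hx i).1 => t; exact: expR_ge0.
Qed.

Lemma measurable_gt_fun (f : T -> R) c : measurable_fun setT f ->
  measurable [set t | c < f t].
Proof.
move=> mf; rewrite (_ : [set _ | _] = f @^-1` `]c, +oo[%classic); last first.
  by apply/seteqP; split=> t /=; rewrite in_itv /= andbT.
by rewrite -[X in measurable X]setTI; apply: mf => //; exact: measurable_itv.
Qed.

Definition mean_alpha v : R := m%:R^-1 * \sum_i mean_cos i v.

Definition cos_sqr_dev u v t : R :=
  `|m%:R^-1 * cos_sqr_sum u v t - mean_alpha v * (dot u u - dot u v ^+ 2)|.

Lemma cos_sqr_concentration u v (s : R) : dot u u <= 1 -> 0 < s <= 1 -> (0 < m)%N ->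
  (P [set t | (s < cos_sqr_dev u v t)%R] <=
    (2 * expR (- (m%:R * s ^+ 2 / 2048)))%:E)%E.
Proof.
move=> u1 /andP[s0 s1] m0.
have mp : 0 < m%:R :> R by rewrite ltr0n.
(* The minimizer of m (512 tau^2 - tau s), with L = tau m s; the minimum is - m s^2 / 2048. *)
pose tau := s / 1024; pose L := m%:R * s ^+ 2 / 1024.
have tau8 : `|tau| <= 8^-1.
  by rewrite /tau ler_norml; apply/andP; split; lra.
have tau8' : `|- tau| <= 8^-1 by rewrite normrN.
have tail (x : R) : x ^+ 2 = tau ^+ 2 ->
    expR (- L + 512 * x ^+ 2 * m%:R) = expR (- (m%:R * s ^+ 2 / 2048)).
  by move=> ->; congr expR; rewrite /L /tau; field.
have := cos_sqr_tail v L u1 tau8; rewrite tail //.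
have := cos_sqr_tail v L u1 tau8'; rewrite tail ?sqrrN //.
set A1 := [set t | _]; set A2 := [set t | _] => P1 P2.
have mA1 : measurable A1.
  by apply: measurable_gt_fun; apply: measurable_funM => //; exact: measurable_cos_sqr_sum.
have mA2 : measurable A2.
  by apply: measurable_gt_fun; apply: measurable_funM => //; exact: measurable_cos_sqr_sum.
apply: (@le_trans _ _ (P (A1 `|` A2))); last first.
  by apply: le_trans (measureU2 _ mA1 mA2) _; rewrite mulr_natl mulr2n EFinD leeD.
have mdev : measurable_fun setT (cos_sqr_dev u v).
  apply: measurableT_comp => //; apply: measurable_funB => //.
  by apply: measurable_funM => //; exact: measurable_cos_sqr_sum.
apply: le_measure; rewrite ?inE; [exact: measurable_gt_fun|exact: measurableU|].
move=> t /=; rewrite /cos_sqr_dev.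
have -> : mean_alpha v * (dot u u - dot u v ^+ 2) = m%:R^-1 * cos_sqr_mean u v.
  by rewrite /mean_alpha /cos_sqr_mean -mulr_suml mulrA.
rewrite -mulrBr normrM gtr0_norm ?invr_gt0 // ltr_pdivlMl //.
rewrite /A1 /A2 /= /tau /L; set y := cos_sqr_sum _ _ _; set z := cos_sqr_mean _ _.
rewrite ltr_normr => /orP[yz|zy]; [right|left].
  have := ltr_pM2l s0 (m%:R * s) (y - z); rewrite yz; lra.
have := ltr_pM2l s0 (m%:R * s) (- (y - z)); rewrite zy; lra.
Qed.

(** Chernoff at the fixed parameter 1/4: each row of S contributes a factor at most 2 <= e. This is
    small once |S| is a small part of m s. *)
Lemma sqr_sum_tail (S : {set 'I_m}) u (s : R) : dot u u <= 1 -> (0 < m)%N ->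
  (P [set t | (s < m%:R^-1 * \sum_(i in S) dot u (row i (a t)) ^+ 2)%R] <=
    (expR (#|S|%:R - m%:R * s / 4))%:E)%E.
Proof.
move=> u1 m0; have mp : 0 < m%:R :> R by rewrite ltr0n.
have mgf i : exists b : R, mean_is P (fun t => expR (dot u (row i (a t)) ^+ 2 / 4)) b /\ b <= 2.
  by have [b Hb b2] := mean_expR_sqr_row i u1; exists b.
have [b Hb] := choice mgf.
have mexp4 : measurable_fun setT (fun x : R => expR (x ^+ 2 / 4)).
  by apply: measurableT_comp => //; apply: measurable_funM.
have Hprod := mean_is_prod indF FI Fm (enum_uniq (mem S))
  (fun i k o ik => row_indices_disj o ik)
  (fun i => adapted_comp mexp4 (@adapted_row_dot i u)) (fun i => (Hb i).1).
pose Y t := \sum_(i in S) dot u (row i (a t)) ^+ 2.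
have mY : measurable_fun setT Y.
  apply: (adapted_measurable Fm (J := predT)); apply: adapted_sum => i _.
  by apply: (sub_adapted (J := row_indices i)) => //; apply: (adapted_comp msqr (@adapted_row_dot i u)).
have {}Hprod : mean_is P (fun t => expR (Y t / 4)) (\prod_(i in S) b i).
  rewrite -big_enum; apply: eq_mean_is Hprod => t.
  by rewrite -expR_sum /Y -mulr_suml big_enum.
rewrite (_ : [set t | _] = [set t | m%:R * s / 4 < Y t / 4]); last first.
  by apply/seteqP; split=> t /=; rewrite ltr_pdivlMl // ltr_pM2r ?invr_gt0.
apply: le_trans (prob_gt_le_mean _ Hprod _) _; first exact: measurable_funM.
rewrite lee_fin addrC expRD ler_wpM2l ?expR_ge0 //.
apply: (@le_trans _ _ (\prod_(i in S) expR 1)); last first.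
  by rewrite prodr_const -expRM_natl mulr1.
apply: ler_prod => i _; apply/andP; split.
  by apply: le_mean_is (mean_is_cst P 0) (Hb i).1 => t; exact: expR_ge0.
by apply: le_trans (Hb i).2 _; have := expR_ge1Dx (1 : R); lra.
Qed.

(** The index [None] carries the support and the signs; these are the indices of the matrix
    entries. *)
Definition matrix_indices : pred (option ('I_m * 'I_n)) := fun o => o != None.

Lemma adapted_cos_sqr_dev u v : adapted F matrix_indices (cos_sqr_dev u v).
Proof.
have sub i : subpred (row_indices i) matrix_indices by case.
apply: (adapted_comp (@normr_measurable R setT)).
apply: adaptedD; last exact: adapted_cst.
apply: adaptedM; first exact: adapted_cst.
by apply: adapted_sum => i _; exact: (sub_adapted (sub i) (@adapted_cos_sqr_row i u v)).
Qed.

Lemma adapted_sqr_sum (S : {set 'I_m}) u :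
  adapted F matrix_indices (fun t => m%:R^-1 * \sum_(i in S) dot u (row i (a t)) ^+ 2).
Proof.
have sub i : subpred (row_indices i) matrix_indices by case.
apply: adaptedM; first exact: adapted_cst.
apply: adapted_sum => i _.
exact: (sub_adapted (sub i) (adapted_comp msqr (@adapted_row_dot i u))).
Qed.

End GaussianMatrix.

(** * Net of the unit ball *)

Section GridNet.
Variables (R : realType) (n : nat).
Hypothesis n_gt0 : (0 < n)%N.

(** The mesh for which n coordinate errors of size h have total square n h^2 = 1/16. *)
Let h : R := (4 * Num.sqrt n%:R)^-1.

Let nR : 0 < n%:R :> R. Proof. by rewrite ltr0n. Qed.

Let sqrtn_gt0 : 0 < Num.sqrt n%:R :> R. Proof. by rewrite sqrtr_gt0. Qed.

Let h_gt0 : 0 < h. Proof. by rewrite invr_gt0 mulr_gt0. Qed.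

Let h_sqr : h ^+ 2 * (16 * n%:R) = 1.
Proof.
rewrite /h exprVn exprMn sqr_sqrtr ?ltW // -[4 ^+ 2]natrX.
by rewrite mulVf // gt_eqF // mulr_gt0.
Qed.

(* an integer vector, each entry given by its sign and absolute value *)
Definition grid := {ffun 'I_n -> bool * 'I_(4 * n).+1}.

Definition grid_point (f : grid) : 'rV[R]_n :=
  \row_i ((-1) ^+ (f i).1 * (f i).2%:R * h).

(** The grid points of the unit ball, because 16 n h^2 = 1. *)
Definition net : {set grid} := [set f : grid | (\sum_i (f i).2 ^ 2 <= 16 * n)%N].

Lemma dot_grid_point_le f : f \in net -> dot (grid_point f) (grid_point f) <= 1.
Proof.
rewrite inE => fn; rewrite dotE.
have -> : \sum_j grid_point f 0 j * grid_point f 0 j = h ^+ 2 * (\sum_j (f j).2 ^ 2)%N%:R.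
  rewrite natr_sum mulr_sumr; apply: eq_bigr => j _.
  rewrite mxE -expr2 !exprMn -exprM mulnC exprM sqrrN expr1n expr1n mul1r.
  by rewrite mulrC natrX.
rewrite -[leRHS]h_sqr ler_wpM2l ?sqr_ge0 //.
by rewrite -natrM ler_nat.
Qed.

Lemma net0 : exists2 f, f \in net & grid_point f = 0.
Proof.
exists [ffun=> (false, ord0)].
  by rewrite inE big1 // => i _; rewrite ffunE.
by apply/rowP => i; rewrite !mxE ffunE /= mulr0 mul0r.
Qed.

(** Each coordinate is rounded towards zero, so the point stays in the ball, with an error at most h
    per coordinate. *)
Lemma net_covers u : dot u u <= 1 ->
  exists2 f, f \in net & dot (u - grid_point f) (u - grid_point f) <= 16^-1.
Proof.
move=> u1; pose x i := `|u 0 i| / h; pose k i := Num.truncn (x i).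
have x0 i : 0 <= x i by rewrite divr_ge0 // ltW.
have kx i : (k i)%:R <= x i < (k i).+1%:R by exact: truncn_itv.
have hx i : x i * h = `|u 0 i| by rewrite divfK // gt_eqF.
have usum : \sum_i x i ^+ 2 <= 16 * n%:R.
  have -> : \sum_i x i ^+ 2 = dot u u * (16 * n%:R).
    rewrite dotE mulr_suml; apply: eq_bigr => i _.
    rewrite -expr2 -(real_normK (num_real (u 0 i))) -hx [(x i * h) ^+ 2]exprMn.
    by rewrite -[RHS]mulrA h_sqr mulr1.
  by rewrite ler_piMl // mulr_ge0 // ltW.
have ksum : (\sum_i k i ^ 2 <= 16 * n)%N.
  rewrite -(ler_nat R) natr_sum natrM; apply: le_trans usum; apply: ler_sum => i _.
  by rewrite natrX ler_pXn2r ?nnegrE //; case/andP: (kx i).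
(* k_i^2 <= 16 n <= (4 n)^2, which justifies the range of the entries of [grid]. *)
have klt i : (k i < (4 * n).+1)%N.
  rewrite ltnS -(@leq_sqr _ _) expnMn.
  apply: (@leq_trans (16 * n)).
    by apply: leq_trans ksum; rewrite (bigD1 i) //= leq_addr.
  by rewrite leq_mul2l /= -mulnn leq_pmulr.
exists [ffun i => (u 0 i < 0, Ordinal (klt i))].
  by rewrite inE; under eq_bigr do rewrite ffunE /=.
rewrite dotE; apply: (@le_trans _ _ (\sum_(i < n) h ^+ 2)); last first.
  rewrite sumr_const card_ord -mulr_natr.
  by have := h_sqr; lra.
apply: ler_sum => i _; rewrite !mxE ffunE /= -expr2.
have -> : u 0 i - (-1) ^+ (u 0 i < 0)%R * (k i)%:R * h =
    (-1) ^+ (u 0 i < 0)%R * ((x i - (k i)%:R) * h).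
  by rewrite mulrBl hx mulrBr -mulrA -numEsign.
rewrite !exprMn -exprM mulnC exprM sqrrN !expr1n mul1r ler_piMl ?sqr_ge0 //.
have /andP[k1 k2] := kx i.
by rewrite expr_le1 ?subr_ge0 //; move: k2; rewrite -natr1; lra.
Qed.

(** Counting the whole grid would give an exponent of order n log n. Instead give f the weight 2^(-
    sum k_i): on the net it is at least 2^(- 16 n), as k <= k^2, while the total weight is at most
    4^n by geometric series. *)
Lemma card_net : (#|net| <= 2 ^ (18 * n))%N.
Proof.
have geo K : \sum_(k < K) (2^-1 : R) ^+ k = 2 - 2 * 2^-1 ^+ K.
  elim: K => [|K IH]; first by rewrite big_ord0 expr0 mulr1 subrr.
  by rewrite big_ord_recr /= IH exprS; field.
pose w (f : grid) : R := \prod_i 2^-1 ^+ (f i).2.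
have w0 f : 0 <= w f by apply: prodr_ge0 => i _; rewrite exprn_ge0.
have total : \sum_f w f <= 4 ^+ n.
  rewrite /w -(bigA_distr_bigA (fun (i : 'I_n) (p : bool * 'I_(4 * n).+1) => 2^-1 ^+ p.2)).
  rewrite prodr_const card_ord lerXn2r ?nnegrE //.
    by apply: sumr_ge0 => p _; rewrite exprn_ge0.
  rewrite -(pair_bigA _ (fun (b : bool) (k : 'I_(4 * n).+1) => (2^-1 : R) ^+ k)) /=.
  rewrite sumr_const card_bool geo [_ *+ 2]mulr2n.
  have : 0 <= (2^-1 : R) ^+ (4 * n).+1 by rewrite exprn_ge0.
  lra.
rewrite -(ler_nat R) natrX.
apply: (@le_trans _ _ (2 ^+ (16 * n) * \sum_(f in net) w f)).
  rewrite mulr_sumr -sum1_card natr_sum; apply: ler_sum => f; rewrite inE => fn.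
  rewrite /w -expr_sum exprVn ler_pdivlMr ?exprn_gt0 // mul1r ler_weXn2l ?ler1n //.
  apply: leq_trans fn; apply: leq_sum => i _.
  by case: (nat_of_ord _) => // k; rewrite -mulnn leq_pmulr.
rewrite -[(18 * n)%N]/((16 + 2) * n)%N mulnDl exprD ler_wpM2l ?exprn_ge0 //.
apply: (@le_trans _ _ (\sum_f w f)).
  rewrite [leRHS](bigID (mem net)) /= lerDl; apply: sumr_ge0 => f _; exact: w0.
apply: le_trans total _; have -> : (4 : R) = 2 ^+ 2 by ring.
by rewrite -exprM.
Qed.

End GridNet.

(** * The good event *)

Section UniformSupport.
Context d (T : measurableType d) (R : realType) (P : probability T R).

Lemma prob_bigsetU_le (J : Type) (s : seq J) (p : pred J) (A : J -> set T) (x : J -> R) :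
  (forall j, p j -> measurable (A j)) -> (forall j, p j -> (P (A j) <= (x j)%:E)%E) ->
  (P (\big[setU/set0]_(j <- s | p j) A j) <= (\sum_(j <- s | p j) x j)%:E)%E.
Proof.
move=> mA PA; elim: s => [|j s IH]; first by rewrite !big_nil measure0.
rewrite !big_cons; case: ifP => // pj.
have mU : measurable (\big[setU/set0]_(j <- s | p j) A j) by exact: bigsetU_measurable.
by apply: le_trans (measureU2 _ (mA j pj) mU) _; rewrite EFinD leeD ?PA.
Qed.

Lemma prob_uniform_support (m k : nat) (S : T -> {set 'I_m})
    (sg : T -> {ffun 'I_m -> bool}) (s1 : {set 'I_m}) : (k <= m)%N ->
  (forall D, measurable ((fun t => (S t, sg t)) @^-1` D)) ->
  (forall (s1 : {set 'I_m}) (sg1 : {ffun 'I_m -> bool}),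
    P ((fun t => (S t, sg t)) @^-1` [set (s1, sg1)]) =
    (if #|s1| == k then ((('C(m, k) * 2 ^ m)%:R : R)^-1)%:E else 0%E)) ->
  (P [set t | S t = s1] <= (if #|s1| == k then 'C(m, k)%:R^-1 else 0 : R)%:E)%E.
Proof.
move=> km mS PS.
have -> : [set t | S t = s1] = \big[setU/set0]_(sg1 : {ffun 'I_m -> bool})
    ((fun t => (S t, sg t)) @^-1` [set (s1, sg1)]).
  rewrite -bigcup_seq; apply/seteqP; split=> t /=.
    by move=> <-; exists (sg t) => //=; rewrite mem_index_enum.
  by move=> [sg1 _ [-> _]].
pose x (sg1 : {ffun 'I_m -> bool}) : R :=
  if #|s1| == k then ('C(m, k) * 2 ^ m)%:R^-1 else 0.
apply: (@le_trans _ _ (\sum_(sg1 : {ffun 'I_m -> bool}) x sg1)%:E).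
  apply: prob_bigsetU_le => sg1 _; first exact: mS.
  by rewrite PS /x; case: ifP.
rewrite lee_fin /x sumr_const card_ffun card_bool card_ord.
case: ifP => _; last by rewrite mul0rn.
by rewrite natrM invfM -[_ *+ (2 ^ m)]mulr_natr -mulrA mulVf ?mulr1.
Qed.

End UniformSupport.

Section GoodEvent.
Context d (T : measurableType d) (R : realType) (P : probability T R).
Variables (m n : nat) (a : T -> 'M[R]_(m, n)).
Variable F : option ('I_m * 'I_n) -> set (set T).
Hypothesis indF : indep_events P F.
Hypothesis FT : forall i, F i setT.
Hypothesis FI : forall i, setI_closed (F i).
Hypothesis Fm : forall i, F i `<=` measurable.
Hypothesis aF : forall i j, events_of_real (fun t => a t i j) `<=` F (Some (i, j)).
Hypothesis am : forall i j, measurable_fun setT (fun t => a t i j).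
Hypothesis alaw : forall i j (B : set R), measurable B ->
  P ((fun t => a t i j) @^-1` B) = normal_prob 0 1 B.
Hypotheses (n0 : (0 < n)%N) (m0 : (0 < m)%N).
Variable s : R.
Hypothesis s01 : 0 < s <= 1.

Let pt := @grid_point R n.

Definition bad_pair (p : grid n * grid n) : set T :=
  [set t | s < cos_sqr_dev P a (pt p.1) (pt p.2) t].

Definition bad_point (S1 : {set 'I_m}) (f : grid n) : set T :=
  [set t | s < m%:R^-1 * \sum_(i in S1) dot (pt f) (row i (a t)) ^+ 2].

Definition bad_event (S1 : {set 'I_m}) : set T :=
  \big[setU/set0]_(p | p \in finset.setX (net n) (net n)) bad_pair p `|`
  \big[setU/set0]_(f in net n) bad_point S1 f.

Definition bad_prob (k : nat) : R :=
  (#|net n| * #|net n|)%:R * (2 * expR (- (m%:R * s ^+ 2 / 2048))) +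
  #|net n|%:R * expR (k%:R - m%:R * s / 4).

Lemma sigma_of_bad_event S1 : sigma_of F (@matrix_indices m n) (bad_event S1).
Proof.
(* Membership in the generated sigma-algebra becomes measurability in this space. *)
pose T' := g_sigma_algebraType (cylinders F (@matrix_indices m n)).
suff : measurable (bad_event S1 : set T') by [].
apply: measurableU; apply: bigsetU_measurable => p _.
  by apply: measurable_gt_fun; exact: adapted_cos_sqr_dev.
by apply: measurable_gt_fun; exact: adapted_sqr_sum.
Qed.

Lemma measurable_bad_event S1 : measurable (bad_event S1).
Proof. exact: (sigma_of_measurable Fm (sigma_of_bad_event S1)). Qed.

Lemma prob_bad_event S1 : (P (bad_event S1) <= (bad_prob #|S1|)%:E)%E.
Proof.
have mpair p : measurable (bad_pair p).
  apply: measurable_gt_fun.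
  apply: (adapted_measurable Fm (J := @matrix_indices m n)).
  exact: adapted_cos_sqr_dev.
have mpoint f : measurable (bad_point S1 f).
  apply: measurable_gt_fun.
  apply: (adapted_measurable Fm (J := @matrix_indices m n)).
  exact: adapted_sqr_sum.
apply: le_trans (measureU2 _ _ _) _; [exact: bigsetU_measurable|exact: bigsetU_measurable|].
rewrite EFinD; apply: leeD.
  have -> : (#|net n| * #|net n|)%:R * (2 * expR (- (m%:R * s ^+ 2 / 2048))) =
      \sum_(p | p \in finset.setX (net n) (net n)) (2 * expR (- (m%:R * s ^+ 2 / 2048))) :> R.
    by rewrite sumr_const cardsX -[RHS]mulr_natl.
  apply: prob_bigsetU_le => // -[f g]; rewrite finset.in_setX => /= /andP[fn gn].
  apply: (cos_sqr_concentration indF FT FI Fm aF am alaw) => //.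
  exact: dot_grid_point_le.
have -> : #|net n|%:R * expR (#|S1|%:R - m%:R * s / 4) =
    \sum_(f in net n) expR (#|S1|%:R - m%:R * s / 4) :> R.
  by rewrite sumr_const -[RHS]mulr_natl.
apply: prob_bigsetU_le => // f fn.
apply: (sqr_sum_tail indF FT FI Fm aF am alaw) => //.
exact: dot_grid_point_le.
Qed.

Lemma not_bad_event S1 t : ~ bad_event S1 t ->
  (forall f g, f \in net n -> g \in net n -> cos_sqr_dev P a (pt f) (pt g) t <= s) /\
  (forall f, f \in net n ->
    m%:R^-1 * \sum_(i in S1) dot (pt f) (row i (a t)) ^+ 2 <= s).
Proof.
move=> nbad; split=> [f g fn gn|f fn]; rewrite leNgt; apply/negP => lt; apply: nbad.
  left; rewrite -bigcup_seq_cond; exists (f, g) => //=.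
  by rewrite mem_index_enum finset.in_setX fn.
right; rewrite -bigcup_seq_cond; exists f => //=.
by rewrite mem_index_enum.
Qed.

End GoodEvent.

(** * Numerical constants *)

Section Constants.
Variable R : realType.

(* m s^2 / 2048 = m / (rate_const r^2) for s = 1 / (408 r) *)
Definition rate_const : R := 2048 * 408 ^+ 2.

Lemma rate_const_gt0 : 0 < rate_const.
Proof. by rewrite /rate_const -natrX -natrM ltr0n muln_gt0 expn_gt0. Qed.

Lemma threshold_bounds (r : nat) : (0 < r)%N -> 0 < (408 * r%:R : R)^-1 <= 1.
Proof.
move=> r0; have p : 0 < 408 * r%:R :> R by rewrite -natrM ltr0n muln_gt0.
by rewrite invr_gt0 p (invf_le1 p) -natrM ler1n muln_gt0.
Qed.

(** Put x = m s^2 / 2048. As 3264 = 8 * 408, k <= m s / 8, so the second exponent is at most - m s /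
    8 <= - x. The two terms add up to at most 3 exp (36 n - x), and x >= 76 n leaves x / 2 >= 38 n
    >= 36 n + 2, with 3 <= e^2. *)
Lemma bad_prob_le (m n r k : nat) : (0 < n)%N -> (0 < m)%N -> (0 < r)%N ->
  76 * rate_const * n%:R * r%:R ^+ 2 <= m%:R ->
  k%:R / m%:R <= 3264^-1 / r%:R :> R ->
  bad_prob m n ((408 * r%:R)^-1 : R) k <=
    expR (- ((2 * rate_const)^-1 * m%:R / r%:R ^+ 2)).
Proof.
move=> n0 m0 r0; have := rate_const_gt0.
have [K KE] : exists K, K = rate_const by exists rate_const.
rewrite -KE => K0 mn km.
have mp : 0 < m%:R :> R by rewrite ltr0n.
have rp : 0 < r%:R :> R by rewrite ltr0n.
have r1 : 1 <= r%:R :> R by rewrite ler1n.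
have n1 : 1 <= n%:R :> R by rewrite ler1n.
have r2p : 0 < r%:R ^+ 2 :> R by rewrite exprn_gt0.
have /andP[] := threshold_bounds r0.
set s : R := (408 * r%:R)^-1 => sp s1.
rewrite /bad_prob; set x := m%:R * s ^+ 2 / 2048; set N := #|net n|.
have xE : x = m%:R / (K * r%:R ^+ 2).
  rewrite KE /x /s /rate_const exprVn exprMn -mulrA -invfM; congr (_ / _).
  by ring.
have -> : (2 * K)^-1 * m%:R / r%:R ^+ 2 = x / 2.
  by rewrite xE; field; rewrite !gt_eqF.
have nx : 76 * n%:R <= x.
  by rewrite xE (ler_pdivlMr _ _ (mulr_gt0 K0 r2p)); move: mn; lra.
have kx : k%:R - m%:R * s / 4 <= - x.
  have km' : k%:R <= m%:R * s / 8.
    move: km; rewrite ler_pdivrMr // => km; apply: le_trans km _.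
    rewrite /s le_eqVlt; apply/orP; left; apply/eqP; rewrite -invfM mulrC.
    by rewrite -[in RHS]mulrA -invfM; congr (_ / _); ring.
  have : x <= m%:R * s / 8.
    have : m%:R * s * s <= m%:R * s * 1 by rewrite ler_wpM2l // ltW // mulr_gt0.
    have : 0 < m%:R * s by rewrite mulr_gt0.
    by rewrite /x expr2; lra.
  lra.
have e1 : 2 <= expR 1 :> R by have := expR_ge1Dx (1 : R); lra.
have NE : N%:R <= expR (18 * n%:R) :> R.
  apply: (@le_trans _ _ ((2 : R) ^+ (18 * n))).
    by rewrite -natrX ler_nat; exact: card_net.
  rewrite -natrM -[X in expR X]mulr1 expRM_natl.
  by rewrite lerXn2r ?nnegrE ?expR_ge0.
have NN : N%:R <= N%:R * N%:R :> R.
  rewrite -natrM ler_nat; case: (N) => // N'.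
  by rewrite leq_pmull.
have NNE : N%:R * N%:R <= expR (36 * n%:R) :> R.
  rewrite (_ : 36 * n%:R = 18 * n%:R + 18 * n%:R); last by ring.
  by rewrite expRD; apply: ler_pM.
have ek : expR (k%:R - m%:R * s / 4) <= expR (- x) by rewrite ler_expR.
apply: (@le_trans _ _ (3 * expR (36 * n%:R) * expR (- x))).
  rewrite natrM.
  have h1 : N%:R * expR (k%:R - m%:R * s / 4) <= expR (36 * n%:R) * expR (- x).
    by apply: ler_pM; rewrite ?expR_ge0 //; exact: le_trans NN NNE.
  have := ler_wpM2r (expR_ge0 (- x)) NNE; move: h1; lra.
apply: (@le_trans _ _ (expR 2 * expR (36 * n%:R) * expR (- x))).
  rewrite ler_wpM2r ?expR_ge0 // ler_wpM2r ?expR_ge0 //.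
  by have := expR_ge1Dx (2 : R); lra.
by rewrite -!expRD ler_expR; lra.
Qed.

End Constants.

Theorem theorem1 (R : realType) :
  exists (c1 s0 c2 gamma : R), 0 < c1 /\ 0 < s0 < 1 /\ 0 < c2 /\ 0 < gamma /\
  forall (n r m k : nat) (X0 : 'M[R]_n) (eps : R) (w : 'I_m -> R) (b : 'I_m -> R)
    (d : measure_display) (T : measurableType d) (P : probability T R)
    (a : T -> 'M[R]_(m, n)) (S : T -> {set 'I_m}) (sg : T -> {ffun 'I_m -> bool}),
  (* X0 : fixed PSD matrix of rank r *)
  psd X0 -> \rank X0 = r -> (0 < r)%N ->
  (* noise *)
  l1norm w <= eps ->
  (* outliers: ||beta||_0 = k = s m, arbitrary nonzero magnitudes b i *)
  (k <= m)%N -> (forall i, 0 < b i) ->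
  (* i.i.d. standard Gaussian sensing entries *)
  (forall i j, measurable_fun setT (fun t => a t i j)) ->
  (forall i j (B : set R), measurable B ->
      P ((fun t => a t i j) @^-1` B) = normal_prob 0 1 B) ->
  (* support uniform among k-subsets, signs i.i.d. Rademacher, independent of
     the support *)
  (forall D, measurable ((fun t => (S t, sg t)) @^-1` D)) ->
  (forall (s1 : {set 'I_m}) (sg1 : {ffun 'I_m -> bool}),
      P ((fun t => (S t, sg t)) @^-1` [set (s1, sg1)]) =
      (if #|s1| == k then ((('C(m, k) * 2 ^ m)%:R : R)^-1)%:E else 0%E)) ->
  (* all these random quantities are mutually independent *)
  indep_events P
    (fun o : option ('I_m * 'I_n) => match o with
      | None => events_of_fin (fun t => (S t, sg t))
      | Some ij => events_of_real (fun t => a t ij.1 ij.2)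
      end) ->
  (* sample-size and outlier-fraction conditions *)
  c1 * n%:R * r%:R ^+ 2 <= m%:R ->
  k%:R / m%:R <= s0 / r%:R ->
  exists E : set T, measurable E /\
    (E `<=` [set t | forall Xh : 'M[R]_n,
        is_l1_minimizer (a t)
          (fun i => Aop (a t) X0 i
                    + (if i \in S t then (if sg t i then b i else - b i) else 0)
                    + w i) Xh ->
        frob (Xh - X0) <= c2 * r%:R * eps / m%:R]) /\
    ((1 - expR (- (gamma * m%:R / r%:R ^+ 2)))%:E <= P E)%E.
Proof.
have K0 := rate_const_gt0 R.
exists (76 * rate_const R), 3264^-1, 136, (2 * rate_const R)^-1.
split; first by rewrite pmulr_rgt0 ?ltr0n.
split; first by rewrite invr_gt0 ltr0n invf_lt1 ?ltr0n // ltr1n.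
split; first by rewrite ltr0n.
split; first by rewrite invr_gt0 pmulr_rgt0 ?ltr0n.
move=> n r m k X0 eps w b d T P a S sg X0p X0r r0 weps km bpos am alaw mS PS.
set F := (F in indep_events P F) => indF mn kms.
have n0 : (0 < n)%N by rewrite (leq_trans r0) // -X0r rank_leq_row.
have rp : 0 < r%:R :> R by rewrite ltr0n.
have m0 : (0 < m)%N.
  rewrite -(ltr0n R); apply: lt_le_trans mn.
  by rewrite !mulr_gt0 ?ltr0n // exprn_gt0.
have FT o : F o setT.
  by case: o => [ij|]; exists setT => //; exact: measurableT.
have FI o : setI_closed (F o).
  case: o => [ij|] _ _ [A mA <-] [B mB <-]; exists (A `&` B) => //.
  exact: measurableI.
have Fm o : F o `<=` measurable.
  case: o => [ij|] _ [A mA <-]; last exact: mS.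
  by rewrite -[X in measurable X]setTI; exact: am.
have aF i j : events_of_real (fun t => a t i j) `<=` F (Some (i, j)) by [].
pose s : R := (408 * r%:R)^-1.
have s01 : 0 < s <= 1 by exact: threshold_bounds.
pose Bad := bad_event P a s.
have mBad s1 : measurable (Bad s1) by exact: (measurable_bad_event P FT Fm aF).
have mSs s1 : measurable [set t | S t = s1].
  exact: (mS [set p : {set 'I_m} * {ffun 'I_m -> bool} | p.1 = s1]).
(* Splitting by the value of the support makes the event a finite union of measurable sets, and the
   deterministic theorem applies with [s1] fixed on each piece. *)
pose E := \big[setU/set0]_(s1 : {set 'I_m} | #|s1| == k) ([set t | S t = s1] `&` ~` Bad s1).
have mE : measurable E.
  by apply: bigsetU_measurable => s1 _; apply: measurableI => //; exact: measurableC.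
exists E; split=> //; split.
  move=> t; rewrite /E -bigcup_seq_cond => -[s1 _ [/= St nbad]] Xh hmin.
  have [conc concS] := not_bad_event nbad.
  pose V (v : 'rV[R]_n) := exists2 f, f \in net n & v = grid_point R f.
  apply: (@recovery_of_net_concentration _ m n r (a t) s1 V (mean_alpha P a) _ w
    X0 Xh eps X0p X0r r0 m0 weps _ _ _ _ _ _ hmin).
  - by move=> i; rewrite St => /negbTE ->.
  - move=> u u1; have [f fn uf] := net_covers n0 u1.
    exists (grid_point R f); split=> //; first by exists f.
    exact: dot_grid_point_le.
  - by have [f fn f0] := net0 R n; exists f.
  - move=> _ [f fn ->]; rewrite /mean_alpha ler_pdivlMl ?ltr0n //.
    have -> : m%:R * 2^-1 = \sum_(i < m) 2^-1 :> R.
      by rewrite sumr_const card_ord mulr_natl.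
    apply: ler_sum => i _; apply: (mean_cos_ge indF FT FI Fm aF am alaw).
    exact: dot_grid_point_le.
  - by move=> _ _ [f fn ->] [g gn ->]; exact: conc.
  - by move=> _ [f fn ->]; exact: concS.
have PSs s1 := prob_uniform_support s1 km mS PS.
pose del := bad_prob m n s k.
have PnE : (P (~` E) <= del%:E)%E.
  pose B s1 := [set t | S t = s1] `&` (if #|s1| == k then Bad s1 else setT).
  have mB s1 : measurable (B s1) by apply: measurableI => //; case: ifP.
  apply: (@le_trans _ _ (P (\big[setU/set0]_(s1 : {set 'I_m}) B s1))).
    apply: le_measure; rewrite ?inE; [exact: measurableC|exact: bigsetU_measurable|].
    move=> t nE; rewrite -bigcup_seq; exists (S t); first by rewrite /= mem_index_enum.
    split=> //; case: ifP => // Sk; apply: contrapT => nbad; apply: nE.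
    by rewrite /E -bigcup_seq_cond; exists (S t) => //=; rewrite mem_index_enum.
  (* The weights 1 / C(m, k) sum to 1 over the supports of size k, so the average costs no factor;
     supports of any other size have probability 0. *)
  pose x (s1 : {set 'I_m}) : R := if #|s1| == k then 'C(m, k)%:R^-1 * del else 0.
  have -> : del = \sum_(s1 : {set 'I_m}) x s1.
    rewrite /x -big_mkcond sumr_const /=.
    have -> : #|[pred s1 : {set 'I_m} | #|s1| == k]| = 'C(m, k).
      by rewrite -[in RHS](card_ord m) -card_draws cardsE.
    rewrite -[RHS]mulr_natl mulrA mulfV ?mul1r //.
    by rewrite pnatr_eq0 -lt0n bin_gt0.
  apply: prob_bigsetU_le => // s1 _; have := PSs s1; rewrite /B /x.
  case: ifP => [/eqP sk|_] Ps1; last by rewrite setIT.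
  (* For a fixed [s1] the bad event depends on the matrix only, hence is independent of the
     support. *)
  have -> : P ([set t | S t = s1] `&` Bad s1) = (P [set t | S t = s1] * P (Bad s1))%E.
    apply: (sigma_of_indep indF FI Fm (J := pred1 None) (K := @matrix_indices m n)).
    - by case.
    - apply: (generator_sub_sigma_of FT (i := None)) => //=.
      by exists [set p : {set 'I_m} * {ffun 'I_m -> bool} | p.1 = s1].
    - exact: (sigma_of_bad_event P FT aF).
  rewrite EFinM; apply: lee_pmul => //.
  by rewrite /del -sk; apply: (prob_bad_event indF FT FI Fm aF am alaw).
have delle : del <= expR (- ((2 * rate_const R)^-1 * m%:R / r%:R ^+ 2)).
  exact: bad_prob_le.
have PE : P E = (1 - P (~` E))%E by rewrite -[in LHS](setCK E) probability_setC //; exact: measurableC.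
rewrite PE EFinB leeB // (le_trans PnE) // lee_fin //.
Qed.
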